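(* Let $G=(V,E)$ be a graph, $p\colon V\to\mathbb{Z}_{>0}$, $\prec$ a total order on $V$, and $U\subseteq V$; let $S_U=\{v\in U:\bar N^-(v)\cap U=\emptyset\}$. If $G[U]$ is a $\chi$-critical web or a $\chi$-critical antiweb, then the inequality \[\sum_{v\in U\setminus S_U}\ \sum_{u\in(\bar N^-(v)\setminus U)\cup\{v\}}x_{uv}\ \ge\ \chi(G[U])-|S_U|\] is facet-defining for $\mathcal P(G,p)$.
   Context: $\chi(H)$ is the chromatic number of $H$; $H$ is $\chi$-critical if $\chi(H-v)<\chi(H)$ for every vertex $v$. For integers $\ell\ge2$, $q\ge 2\ell$, the web $W^q_\ell$ has vertices $v_0,\dots,v_{q-1}$ and edges $v_iv_j$ with $\ell\le|i-j|\le q-\ell$; the antiweb $\bar W^q_\ell$ is its complement. ''$G[U]$ is a web/antiweb'' means it is isomorphic to one. $n=|V|$, $\bar E$ is the edge set of the complement of $G$ and $\bar e=|\bar E|$. Let $\bar N^-(w)=\{u\in V: u\prec w,\ \{u,w\}\notin E\}$, $\bar N^+(w)=\{u\in V: w\prec u,\ \{u,w\}\notin E\}$, $\bar N^-[w]=\bar N^-(w)\cup\{w\}$, $S=\{w:\bar N^-(w)=\emptyset\}$, $T=\{w:\bar N^+(w)=\emptyset\}$. Variables: $x_{uw}$ for $w\in V$, $u\in\bar N^-(w)$, and $x_{ww}$ for $w\in V\setminus S$ (so $n+\bar e-|S|$ variables), plus a real variable $y$. $\mathcal K(w)$ is the collection of subsets of $\bar N^+(w)$ inducing a clique of size 2 in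 $G$ or a maximal clique of size 1 in $G[\bar N^+(w)]$. Constraints: (C1) $\sum_{u\in\bar N^-[w]}x_{uw}\ge1$ for $w\in V\setminus S$; (C2) $\sum_{u\in K}x_{wu}\le x_{ww}$ for $w\in(V\setminus T)\setminus S$, $K\in\mathcal K(w)$; (C3) $\sum_{u\in K}x_{wu}\le 1$ for $w\in(V\setminus T)\cap S$, $K\in\mathcal K(w)$; (C4) $p(w)x_{ww}+\sum_{u\in\bar N^+(w)}p(u)x_{wu}\le y$ for $w\in V\setminus S$; (C5) $p(w)+\sum_{u\in\bar N^+(w)}p(u)x_{wu}\le y$ for $w\in S$. $\mathcal P(G,p)=\operatorname{conv}\{(y,x)\in\mathbb{R}_{\ge0}\times\{0,1\}^{n+\bar e-|S|}:(y,x)\text{ satisfies (C1)–(C5)}\}$. *)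

(* Defs.v *)
From HB Require Import structures.
From mathcomp Require Import all_boot all_order all_algebra.
From mathcomp Require Import reals.

Set Implicit Arguments.
Unset Strict Implicit.
Unset Printing Implicit Defensive.

Import Order.TTheory GRing.Theory Num.Theory.
Local Open Scope ring_scope.

Definition colorable (T : finType) (e : rel T) (k : nat) : bool :=
  [exists f : {ffun T -> 'I_k}, forall x, forall y, e x y ==> (f x != f y)].

(** For irreflexive [e], [ord_max] (i.e. [#|T|] colors) is always admissible,
    so this is the least [k] such that [e] is [k]-colorable. *)
Definition chi (T : finType) (e : rel T) : nat :=
  [arg min_(k < (ord_max : 'I_#|T|.+1) | colorable e k) (k : nat)].

Definition induced (T : finType) (e : rel T) (U : {set T}) :
  rel {x : T | x \in U} := relpre val e.
Arguments induced {T} e U.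

Definition chi_critical (T : finType) (e : rel T) : Prop :=
  forall v : T, (chi (induced e [set~ v]) < chi e)%N.

Definition graph_iso (T T' : finType) (e : rel T) (e' : rel T') : Prop :=
  exists2 f : T -> T', bijective f & {mono f : x y / e x y >-> e' x y}.

Definition web (q l : nat) : rel 'I_q :=
  fun i j => (l <= `|i - j| <= q - l)%N.
Arguments web q l i j : clear implicits.

Definition antiweb (q l : nat) : rel 'I_q :=
  fun i j => (i != j) && ~~ web q l i j.
Arguments antiweb q l i j : clear implicits.

Definition is_web (T : finType) (e : rel T) : Prop :=
  exists q l : nat, [/\ (2 <= l)%N, (2 * l <= q)%N & graph_iso e (web q l)].

Definition is_antiweb (T : finType) (e : rel T) : Prop :=
  exists q l : nat, [/\ (2 <= l)%N, (2 * l <= q)%N & graph_iso e (antiweb q l)].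

Definition is_clique (T : finType) (e : rel T) (K : {set T}) : bool :=
  [forall u in K, forall v in K, (u != v) ==> e u v].

Definition conv_hull (R : realType) (E : lmodType R) (A : E -> Prop) (z : E) :
    Prop :=
  exists (k : nat) (a : 'I_k -> R) (s : 'I_k -> E),
    [/\ forall i, 0 <= a i, \sum_(i < k) a i = 1, forall i, A (s i)
      & z = \sum_(i < k) a i *: s i].

(** Affine independence of the [(size s).+1] points [z0 :: s] of [A]. *)
Definition aff_indep_in (R : realType) (E : vectType R) (A : E -> Prop)
    (z0 : E) (s : seq E) : Prop :=
  [/\ A z0, forall z, z \in s -> A z & free [seq z - z0 | z <- s]].

Definition has_dim (R : realType) (E : vectType R) (A : E -> Prop) (n : nat) :
    Prop :=
  (exists z0 s, aff_indep_in A z0 s /\ size s = n) /\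
  (forall z0 s, aff_indep_in A z0 s -> (size s <= n)%N).

Definition facet_defining (R : realType) (E : vectType R) (P : E -> Prop)
    (f : {scalar E}) (b : R) : Prop :=
  (forall z, P z -> b <= f z) /\
  (exists n : nat, has_dim P n.+1 /\ has_dim (fun z => P z /\ f z = b) n).

Section Representatives.

Context (d : Order.disp_t) (V : finOrderType d) (e : rel V).

(** [aNm] and [aNp] are the sets of anti-neighbors (non-neighbors) preceding,
    resp. following, a vertex. *)
Definition aNm (w : V) : {set V} := [set u | (u < w)%O && ~~ e u w].
Definition aNp (w : V) : {set V} := [set u | (w < u)%O && ~~ e u w].

Definition srcs : {set V} := [set w | aNm w == set0].
Definition sinks : {set V} := [set w | aNp w == set0].

Definition is_xvar (uw : V * V) : bool :=
  (uw.1 \in aNm uw.2) || (uw.1 == uw.2) && (uw.2 \notin srcs).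

Definition xvar : finType := {uw : V * V | is_xvar uw}.

Definition repcliques (w : V) : {set {set V}} :=
  [set K : {set V} |
    [&& K \subset aNp w, is_clique e K & #|K| == 2%N]
    || maxset (fun K' => (K' \subset aNp w) && is_clique e K') K
       && (#|K| == 1%N)].

Section Polytope.

Context (R : realType).

Definition rep_space : vectType R := (R^o * {ffun xvar -> R^o})%type.

Definition yval (z : rep_space) : R := z.1.

(** The default value [0] is never reached below: only pairs satisfying
    [is_xvar] are used. *)
Definition xval (z : rep_space) (u w : V) : R :=
  if insub (u, w) is Some i then z.2 i else 0.

Definition feasible (p : V -> nat) (z : rep_space) : Prop :=
  [/\ forall w, w \notin srcs ->
        1 <= \sum_(u in w |: aNm w) xval z u w,
      forall w K, w \notin sinks -> w \notin srcs -> K \in repcliques w ->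
        \sum_(u in K) xval z w u <= xval z w w,
      forall w K, w \notin sinks -> w \in srcs -> K \in repcliques w ->
        \sum_(u in K) xval z w u <= 1,
      forall w, w \notin srcs ->
        (p w)%:R * xval z w w + \sum_(u in aNp w) (p u)%:R * xval z w u
          <= yval z
    & forall w, w \in srcs ->
        (p w)%:R + \sum_(u in aNp w) (p u)%:R * xval z w u <= yval z].

Definition feasible_01 (p : V -> nat) (z : rep_space) : Prop :=
  [/\ 0 <= yval z, forall i : xvar, z.2 i = 0 \/ z.2 i = 1 & feasible p z].

Definition rep_polytope (p : V -> nat) : rep_space -> Prop :=
  conv_hull (feasible_01 p).

Definition srcs_in (U : {set V}) : {set V} :=
  [set v in U | aNm v :&: U == set0].

Definition ineq_lhs (U : {set V}) (z : rep_space) : R :=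
  \sum_(v in U :\: srcs_in U) \sum_(u in v |: (aNm v :\: U)) xval z u v.

Lemma xval_is_scalar u w : scalar (fun z => xval z u w).
Proof.
move=> a z z'; rewrite /xval; case: insubP => [i _ _|_] /=.
  by rewrite !ffunE.
by rewrite mulr0 addr0.
Qed.

Lemma ineq_lhs_is_scalar U : scalar (ineq_lhs U).
Proof.
move=> a z z'; rewrite /ineq_lhs mulr_sumr -big_split; apply: eq_bigr => v _.
rewrite mulr_sumr -big_split; apply: eq_bigr => u _; exact: xval_is_scalar.
Qed.

HB.instance Definition _ U :=
  GRing.isLinear.Build R rep_space R *%R (ineq_lhs U) (ineq_lhs_is_scalar U).

End Polytope.

End Representatives.

Arguments rep_polytope {d V} e R p z.
Arguments ineq_lhs {d V} e R U z.

(* Main.v *)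
Require Import Defs.
From HB Require Import structures.
From mathcomp Require Import all_boot all_order all_algebra zify.
From mathcomp Require Import boolp reals.

(** Validity: in a 0/1 solution, let every vertex of [U] that is
    represented by an earlier vertex of [U] take the color of that vertex, and
    every other vertex of [U] be a color of its own; the number of colors is at
    most [#|S_U|] plus the left-hand side.

    Facet: we show that a linear form [phi] which is constant on the face is a
    multiple of the left-hand side.  Criticality gives optimal colorings of
    [U] in which a prescribed vertex is alone in its class; letting such a
    vertex represent one more vertex, or be represented from outside [U], shows
    that every coefficient outside the support of the inequality vanishes, and
    that the coefficient of [x_uv], [u] outside [U], equals that of [x_vv].
    Hence the sum of [phi x_vv] over the minima of the color classes is the same
    for all optimal colorings of [U], and all [phi x_vv] with [v] in [U] outside
    [S_U] must be shown to be equal.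

    Counting color classes, a critical web or antiweb with chromatic number
    [k + 1] and stability number [al] has exactly [al * k + 1] vertices, and
    these can be listed cyclically so that any [al] consecutive ones are stable.
    Removing one vertex leaves [k] intervals; recoloring an interval together
    with the removed vertex exchanges one class minimum against another, which
    links all vertices outside [S_U] whatever the order on the vertices is. *)

Set Implicit Arguments.
Unset Strict Implicit.
Unset Printing Implicit Defensive.

Import Order.TTheory GRing.Theory Num.Theory.
Local Open Scope ring_scope.

(** * A criterion for facets *)

Section FacetCriterion.
Context (R : realType) (E : vectType R).
Implicit Types (A P : E -> Prop) (D : {vspace E}).

(** Subtracting from [x] its projection onto [D] leaves a nonzero vector, so some coordinate of it
    is nonzero; [phi] reads that coordinate of the residue and therefore kills [D]. *)
Lemma separating_functional D x : x \notin D ->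
  exists2 phi : 'Hom(E, R^o), {in D, forall v, phi v = 0} & phi x != 0.
Proof.
move=> xD.
pose y := x - projv D x.
have y0 : y != 0.
  by apply: contraNneq xD => /eqP; rewrite subr_eq0 => /eqP->; apply: memv_proj.
have [i yi] : exists i, coord (vbasis {:E}) i y != 0.
  apply/existsP; apply: contraNT y0; rewrite negb_exists => /forallP y0.
  rewrite (coord_vbasis (memvf y)) big1 // => i _.
  by move: (y0 i); rewrite negbK => /eqP->; rewrite scale0r.
exists (linfun (coord (vbasis {:E}) i : E -> R^o) \o (\1 - projv D))%VF.
  move=> v vD; rewrite comp_lfunE lfunE /= add_lfunE opp_lfunE id_lfunE projv_id //.
  by rewrite subrr linear0.
by rewrite comp_lfunE lfunE /= add_lfunE opp_lfunE id_lfunE.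
Qed.

Lemma maximal_aff_indep A z0 : A z0 ->
  exists2 s, aff_indep_in A z0 s &
    forall z, A z -> z - z0 \in <<[seq z' - z0 | z' <- s]>>%VS.
Proof.
move=> Az0.
(* Induction on a bound [n] for the number of points that can still be added: a free family is never
   longer than the dimension of the space. *)
suff H n s : (\dim {:E} - size s <= n)%N -> aff_indep_in A z0 s ->
    exists2 s', aff_indep_in A z0 s' &
      forall z, A z -> z - z0 \in <<[seq z' - z0 | z' <- s']>>%VS.
  by apply: (H _ [::] (leqnn _)); split => //=; rewrite nil_free.
elim: n s => [|n IHn] s hs sP; have [_ sA sfree] := sP;
  (have [hz|] := pselect (forall z, A z -> z - z0 \in <<[seq z' - z0 | z' <- s]>>%VS);
    first by exists s);
  move=> /existsNP[z /not_implyP[Az /negP zs]];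
  have szs : free [seq z' - z0 | z' <- z :: s] by rewrite /= free_cons zs.
- move: szs; rewrite /free size_map /= => /eqP sz.
  have := dimvS (subvf <<[seq z' - z0 | z' <- z :: s]>>%VS).
  by rewrite /= sz -subn_gt0 -ltnS ltnNge => /negP[]; rewrite ltnS.
- apply: (IHn (z :: s)).
    by rewrite /= subnS; case: (_ - size s)%N hs.
  by split => // z'; rewrite inE => /predU1P[->//|]; apply: sA.
Qed.

(** Reduces a dimension count to linear forms. Differences of points of [A] stay in [D], which
    bounds every family; a maximal family spans [D], since otherwise a separating form would vanish
    on [A] but not on [D]. *)
Lemma has_dim_span A D z0 : A z0 -> (forall z, A z -> z - z0 \in D) ->
  (forall phi : 'Hom(E, R^o), (forall z, A z -> phi (z - z0) = 0) ->
    {in D, forall v, phi v = 0}) ->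
  has_dim A (\dim D).
Proof.
move=> Az0 AD sep; split.
  have [s sP sA] := maximal_aff_indep Az0; exists z0, s; split=> //.
  have [_ As sfree] := sP.
  suff <- : <<[seq z' - z0 | z' <- s]>>%VS = D.
    by move: sfree; rewrite /free size_map => /eqP.
  apply/eqP; rewrite eqEsubv; apply/andP; split.
    by apply/span_subvP => _ /mapP[z zs ->]; apply/AD/As.
  apply/subvP => v vD; apply: contraT => /separating_functional[phi phi0].
  by rewrite sep ?eqxx // => z Az; apply/phi0/sA.
move=> z1 s [Az1 As]; rewrite /free size_map => /eqP <-.
apply: dimvS; apply/span_subvP => _ /mapP[z zs ->].
have -> : z - z1 = (z - z0) - (z1 - z0) by rewrite opprB addrA subrK.
by apply: memvB; apply: AD => //; apply: As.
Qed.

(** The face spans the kernel of [f], a hyperplane, and [P] spans the whole space. Both facts follow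
    from [mult], so no affinely independent points have to be exhibited. *)
Lemma facet_criterion P (f : {scalar E}) (b : R) :
  (forall z, P z -> b <= f z) ->
  (exists z, P z /\ f z = b) -> (exists z, P z /\ f z != b) ->
  (forall phi : 'Hom(E, R^o),
    (exists C, forall z, P z -> f z = b -> phi z = C) ->
    exists c, forall z, phi z = c * f z) ->
  facet_defining P f b.
Proof.
move=> valid [z0 [Pz0 fz0]] [z1 [Pz1 fz1]] mult; split=> //.
pose f' : 'Hom(E, R^o) := linfun (f : E -> R^o).
have f'E z : f' z = f z by rewrite lfunE.
have img1 : \dim (limg f') = 1%N.
  have le1 : (\dim (limg f') <= 1)%N.
    by apply: leq_trans (dimvS (subvf _)) _; rewrite dimvf.
  apply/eqP; rewrite eqn_leq le1 lt0n dimv_eq0; apply/negP => /eqP img0.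
  have : f' (z1 - z0) \in limg f' by rewrite memv_img ?memvf.
  by rewrite img0 memv0 f'E linearB /= fz0 subr_eq0 (negPf fz1).
have dimE := limg_ker_dim f' {:E}; rewrite img1 capfv addn1 in dimE.
exists (\dim (lker f')); split.
  (* A form constant on [P] is constant on the face, hence is [c * f]; as [f] takes two values on
     [P], [c] is zero. *)
  rewrite dimE; apply: (@has_dim_span _ _ z0) => // [z _|phi phi0 v _].
    exact: memvf.
  have [|c phiE] := mult phi.
    by exists (phi z0) => z Pz _; apply/eqP; rewrite -subr_eq0; apply/eqP; rewrite -(phi0 z Pz) linearB.
  have := phi0 _ Pz1; rewrite phiE linearB /= fz0 => /eqP.
  by rewrite mulf_eq0 subr_eq0 (negPf fz1) orbF phiE => /eqP->; rewrite mul0r.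
apply: (@has_dim_span _ _ z0) => // [z [_ fz]|phi phi0 v].
  by rewrite memv_ker f'E linearB /= fz fz0 subrr.
rewrite memv_ker f'E => /eqP fv; have [|c ->] := mult phi; last by rewrite fv mulr0.
exists (phi z0) => z Pz fz; apply/eqP.
by rewrite -subr_eq0; apply/eqP; rewrite -(phi0 z) // linearB.
Qed.
End FacetCriterion.

(** * Exchanging class minima in cyclically ordered graphs *)

Definition stable (T : finType) (e : rel T) (A : {set T}) : Prop :=
  {in A &, forall x y, ~~ e x y}.

Definition proper_on (T : finType) (e : rel T) (A : {set T}) (S : eqType)
    (col : T -> S) : Prop :=
  {in A &, forall x y, e x y -> col x != col y}.

Definition class_min d (V : finOrderType d) (U : {set V}) (S : eqType)
    (col : V -> S) (v : V) : bool :=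
  [forall u in U, (col u == col v) ==> (v <= u)%O].

Lemma card_le_nat (T : finType) (A : {set T}) (F : T -> nat) n :
  (forall x, x \in A -> (F x < n)%N) -> {in A &, injective F} -> (#|A| <= n)%N.
Proof.
move=> F_lt F_inj; case: (posnP #|A|) => [->//|/card_gt0P[x0 x0A]].
have n0 : (0 < n)%N by apply: leq_ltn_trans (F_lt _ x0A).
rewrite -[leqRHS]card_ord.
apply: (@leq_card_in _ _ (fun x => insubd (Ordinal n0) (F x))) => x y xA yA /(congr1 val).
by rewrite !val_insubd !F_lt //; apply: F_inj.
Qed.

Lemma same_quotient_lt a b c : (0 < c)%N -> (a %/ c = b %/ c)%N -> (a < b + c)%N.
Proof.
move=> c0 abE; rewrite (divn_eq a c) (divn_eq b c) abE -addnA ltn_add2l.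
by rewrite ltn_addl // ltn_pmod.
Qed.

Ltac natlia :=
  repeat match goal with
  | H : is_true (_ < _)%O |- _ => clear H
  | H : is_true (_ <= _)%O |- _ => clear H
  | H : is_true (in_mem _ _) |- _ => clear H
  | H : is_true (_ || _) |- _ => clear H
  | H : is_true (~~ _) |- _ => clear H
  | H : _ = _ :> bool |- _ => clear H
  | H : stable _ _ |- _ => clear H
  | H : proper_on _ _ _ |- _ => clear H
  | H : forall _, _ |- _ => clear H
  | H : exists2 _, _ & _ |- _ => clear H
  end; lia.

Section Cyclic.
Context (d : Order.disp_t) (V : finOrderType d) (e : rel V).
Hypotheses (e_sym : symmetric e) (e_irr : irreflexive e).
Context (U : {set V}) (q al k : nat) (w : nat -> V).
Hypotheses (al_gt1 : (1 < al)%N) (k_gt0 : (0 < k)%N) (qE : q = (al * k).+1).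
Hypotheses (w_in : forall i, w i \in U)
  (w_surj : forall i v, v \in U -> exists2 t, (t < q)%N & w (i + t) = v)
  (w_inj : forall i t t', (t < q)%N -> (t' < q)%N ->
     w (i + t) = w (i + t') -> t = t')
  (w_stable : forall i j, (i < j < i + al)%N -> ~~ e (w i) (w j)).
Context (R : zmodType) (g : V -> R) (C : R).
Hypothesis sum_min : forall col : V -> nat, proper_on e U col ->
  (forall v, v \in U -> (col v <= k)%N) ->
  \sum_(v in U | class_min U col v) g v = C.

(** Every run of [q] consecutive indices of [w] enumerates [U] once, so vertices are located
    relative to a moving origin [w i] and no index is ever reduced modulo [q]. *)
Let off i v := index v (mkseq (fun t => w (i + t)) q).

Let offK i t : (t < q)%N -> off i (w (i + t)) = t.
Proof.
move=> tq; rewrite /off -[X in index X _](@nth_mkseq _ (w 0) (fun t => w (i + t)) q t tq).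
by rewrite index_uniq ?size_mkseq //; apply/mkseq_uniqP => a b; apply: w_inj.
Qed.

Let w_stable_dist i s t : (s < t + al)%N -> (t < s + al)%N ->
  ~~ e (w (i + s)) (w (i + t)).
Proof.
move=> st ts; case: (ltngtP s t) => [lt|lt|->]; last by rewrite e_irr.
  by apply: w_stable; natlia.
by rewrite e_sym; apply: w_stable; natlia.
Qed.

Definition block i j v : nat := if v == w i then j else ((off i v).-1 %/ al)%N.

(* The vertices w i and w (i + s.+1), j * al <= s < j.+1 * al: the exceptional
   vertex w i is put in the block j where the exchange takes place. *)
Definition block_set i j : {set V} := [set v in U | block i j v == j].

Lemma block_w i j t : (t < q)%N ->
  block i j (w (i + t)) = if t == 0%N then j else (t.-1 %/ al)%N.
Proof.
move=> tq; rewrite /block offK //; case: t tq => [|t] tq.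
  by rewrite addn0 eqxx.
by rewrite -[X in _ == w X]addn0; case: eqP => // /w_inj -/(_ tq); rewrite qE => /(_ isT).
Qed.

Lemma block_lt i j v : (j < k)%N -> v \in U -> (block i j v < k)%N.
Proof.
move=> jk /(w_surj i)[t tq <-]; rewrite block_w //.
by case: eqP => // t0; rewrite ltn_divLR; natlia.
Qed.

(** Every splitting of the block set into two stable parts extends, by the other blocks, to a
    coloring with [k.+1] colors. The other blocks contribute the same minima each time, so the two
    remaining minima have a constant sum. *)
Lemma exchange_sum i j : (j < k)%N -> exists K, forall (P : {set V}) x m,
  P \subset block_set i j -> stable e P -> stable e (block_set i j :\: P) ->
  x \in P -> {in P, forall v, (x <= v)%O} ->
  m \in block_set i j :\: P -> {in block_set i j, forall v, (m <= v)%O} ->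
  g x + g m = K.
Proof.
move=> jk; set B := block_set i j.
(* The contribution of the other blocks, written without reference to [P]. *)
pose rest := \sum_(v in U | (v \notin B) &&
  [forall u in U :\: B, (block i j u == block i j v) ==> (v <= u)%O]) g v.
exists (C - rest) => P x m /subsetP PB Pst BPst xP xmin /setDP[mB mP] mmin.
(* The color [k] is fresh, because blocks are numbered below [k]. *)
pose col v := if v \in P then k else block i j v.
have inB v : v \in B -> block i j v = j by rewrite inE => /andP[_ /eqP].
have BU v : v \in B -> v \in U by rewrite inE => /andP[].
have notB v : v \in U -> v \notin B -> block i j v != j.
  by move=> vU; rewrite inE vU.
have blk := block_lt i jk.
have colP : proper_on e U col.
  move=> a b aU bU eab; apply/eqP; rewrite /col.
  case: ifPn => aP; case: ifPn => bP.
  - by move: eab; rewrite (negPf (Pst _ _ aP bP)).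
  - by move=> kE; have := blk _ bU; rewrite -kE ltnn.
  - by move=> kE; have := blk _ aU; rewrite kE ltnn.
  - case: (boolP (a \in B)) => aB blE.
      have bB : b \in B by rewrite inE bU -blE inB ?eqxx.
      by move: eab; rewrite (negPf (BPst _ _ _ _)) // inE ?aP ?bP.
    have bB : b \notin B by rewrite inE bU /= -blE notB.
    have := notB _ aU aB; have := notB _ bU bB; move: blE eab.
    have [t tq <-] := w_surj i aU; have [s sq <-] := w_surj i bU.
    rewrite !block_w //; case: eqP => [_|t0]; first by rewrite eqxx.
    case: eqP => [_|s0]; first by rewrite eqxx.
    (* Equal quotients by [al] mean positions less than [al] apart, hence non-adjacent vertices. *)
    move=> tsE ew _ _; apply: (negP _ ew); apply: w_stable_dist.
      by have := same_quotient_lt (ltnW al_gt1) tsE; natlia.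
    by have := same_quotient_lt (ltnW al_gt1) (esym tsE); natlia.
have col_le v : v \in U -> (col v <= k)%N.
  by move=> vU; rewrite /col; case: ifP => // _; apply/ltnW/blk.
rewrite -(sum_min colP col_le) (bigID [pred v | v \in B]) /=.
suff -> : \sum_(v | (v \in U) && class_min U col v && (v \in B)) g v = g x + g m.
  suff -> : \sum_(v | (v \in U) && class_min U col v && (v \notin B)) g v = rest.
    by rewrite addrK.
  apply: eq_bigl => v; rewrite -andbA; case: (boolP (v \in U)) => //= vU; rewrite andbC.
  case: (boolP (v \in B)) => //= vB.
  have vP : v \notin P by apply: contra vB; apply: PB.
  apply/forall_inP/forall_inP => H u uU; rewrite /col.
    have /setDP[uU' uB] := uU; have := H u uU'; rewrite /col (negPf vP).
    by rewrite ifN //; apply: contra uB; apply: PB.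
  rewrite (negPf vP); case: ifPn => uP.
    by apply/implyP => /eqP kE; have := blk _ vU; rewrite -kE ltnn.
  case: (boolP (u \in B)) => uB; last by apply: H; rewrite inE uB.
  by apply/implyP => /eqP; rewrite inB // => /esym/eqP; rewrite (negPf (notB _ vU vB)).
have xm : x != m by apply: contraNneq mP => <-.
have -> : g x + g m = \sum_(v in [set x; m]) g v.
  by rewrite big_setU1 ?inE //= big_set1.
apply: eq_bigl => v; rewrite !inE.
have xB := PB _ xP.
rewrite -andbA; apply/and3P/orP => [[vU /forall_inP vmin vB]|].
  have vB' : v \in B by rewrite inE.
  case: (boolP (v \in P)) => vP; [left|right].
    rewrite eq_le xmin // andbT; have := vmin x (BU _ xB).
    by rewrite /col vP xP eqxx.
  rewrite eq_le mmin // andbT; have := vmin m (BU _ mB).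
  by rewrite /col (negPf vP) (negPf mP) !inB // eqxx.
case=> /eqP->.
  have := xB; rewrite inE => /andP[-> ->]; split=> //.
  apply/forall_inP => u uU; rewrite /col xP; case: ifP => [uP|_].
    by apply/implyP => _; apply: xmin.
  by apply/implyP => /eqP kE; have := blk _ uU; rewrite kE ltnn.
have := mB; rewrite inE => /andP[-> ->]; split=> //.
apply/forall_inP => u uU; rewrite /col (negPf mP); case: ifP => [_|_].
  by apply/implyP => /eqP kE; have := blk _ (BU _ mB); rewrite -kE ltnn.
apply/implyP => /eqP; rewrite [RHS]inB // => uE; apply: mmin.
by rewrite inE uU uE eqxx.
Qed.

(* In both splittings of the block set the part avoiding P, resp. P', has the
   overall minimum m as its representative, so g m cancels. *)
Lemma exchange i j (P P' : {set V}) m x x' : (j < k)%N ->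
  m \in block_set i j -> {in block_set i j, forall v, (m <= v)%O} ->
  P \subset block_set i j -> stable e P -> stable e (block_set i j :\: P) ->
  m \notin P -> x \in P -> {in P, forall v, (x <= v)%O} ->
  P' \subset block_set i j -> stable e P' -> stable e (block_set i j :\: P') ->
  m \notin P' -> x' \in P' -> {in P', forall v, (x' <= v)%O} ->
  g x = g x'.
Proof.
move=> /(exchange_sum i)[K sumE] mB mmin PB Pst BPst mP xP xmin.
move=> P'B P'st BP'st mP' xP' xmin'.
apply: (addIr (g m)); rewrite (sumE P) ?inE ?mP //; last by rewrite inE in mB.
by rewrite (sumE P') ?inE ?mP' //; rewrite inE in mB.
Qed.
Lemma block_setP i j v : (j < k)%N -> v \in block_set i j ->
  v = w i \/ exists2 s, (s < al)%N & v = w (i + (j * al + s).+1).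
Proof.
move=> jk; rewrite inE => /andP[/(w_surj i)[t tq <-]]; rewrite block_w //.
case: t tq => [|t] tq; first by rewrite addn0; left.
move=> /eqP <-; right; exists (t %% al)%N; first by rewrite ltn_pmod // ltnW.
by rewrite -divn_eq.
Qed.

Lemma block_set_w i j : w i \in block_set i j.
Proof. by rewrite inE w_in /block eqxx eqxx. Qed.

Lemma block_set_wS i j s : (j < k)%N -> (s < al)%N ->
  w (i + (j * al + s).+1) \in block_set i j.
Proof.
move=> jk sal; rewrite inE w_in /= block_w /=; last first.
  rewrite qE ltnS mulnC; apply: (@leq_trans (al * j.+1)); first by natlia.
  by rewrite leq_pmul2l //; natlia.
by rewrite divnMDl ?divn_small ?addn0 //; natlia.
Qed.

(** * Exchanges inside a window of [al + 1] consecutive vertices *)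

Lemma windowP i v : reflect (exists2 s, (s <= al)%N & v = w (i + s)) (v \in block_set i 0).
Proof.
apply: (iffP idP) => [/(block_setP k_gt0)[->|[s sal ->]]|[[|s] sal ->]].
- by exists 0%N; rewrite ?addn0.
- by exists s.+1.
- by rewrite addn0; apply: block_set_w.
- exact: (@block_set_wS i 0 s).
Qed.

(** Only the two ends of a window are [al] apart, so a subset missing one end is stable. *)
Lemma window_stable i t (A : {set V}) : t = 0%N \/ t = al ->
  A \subset block_set i 0 -> w (i + t) \notin A -> stable e A.
Proof.
move=> tE /subsetP AB tA x y xA yA.
have [s sal xE] := windowP _ _ (AB _ xA).
have [r ral yE] := windowP _ _ (AB _ yA).
have st : s <> t by move=> st; rewrite -st -xE xA in tA.
have rt : r <> t by move=> rt; rewrite -rt -yE yA in tA.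
by rewrite xE yE; apply: w_stable_dist; natlia.
Qed.

Lemma exists_min (A : {set V}) v : v \in A ->
  exists2 m, m \in A & {in A, forall u, (m <= u)%O}.
Proof.
by move=> vA; case: (@Order.TotalTheory.arg_minP _ _ _ v (mem A) id vA) => m mA mmin; exists m.
Qed.

Lemma w_neq i s t : (s <= al)%N -> (t <= al)%N -> s <> t -> w (i + s) != w (i + t).
Proof.
have alq : (al < q)%N by rewrite qE ltnS leq_pmulr.
by move=> sal tal st; apply/eqP => /w_inj; natlia.
Qed.

(** Here [M] is the larger end and [o] the other one. Splitting off [M] alone and splitting off a
    stable set with minimum [x] both leave the overall minimum [m] on the other side, so the
    exchange applies. *)
Lemma window_eq_end i x u t t' :
  (t = 0%N /\ t' = al) \/ (t = al /\ t' = 0%N) -> (w (i + t') <= w (i + t))%O ->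
  x \in block_set i 0 -> u \in block_set i 0 -> (u < x)%O -> (x <= w (i + t))%O ->
  g x = g (w (i + t)).
Proof.
move=> tE; set M := w (i + t); set o := w (i + t') => oM xB uB ux xM.
have [->//|xneM] := eqVneq x M.
have [m mB mmin] := exists_min uB.
have mx : (m < x)%O := le_lt_trans (mmin _ uB) ux.
have MB : M \in block_set i 0 by apply/windowP; exists t => //; natlia.
have oB : o \in block_set i 0 by apply/windowP; exists t' => //; natlia.
have neqMo : o != M by apply: w_neq; natlia.
have tE1 : t = 0%N \/ t = al by natlia.
have tE2 : t' = 0%N \/ t' = al by natlia.
have stM := @window_stable i t _ tE1; have sto := @window_stable i t' _ tE2.
have mneM : m != M by rewrite lt_eqF // (lt_le_trans mx).
(* The set [[set M; x]] has minimum [x] because [x] is at most [M], and it is stable because it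
   misses [o]; when [x] is [o] itself, the singleton is used instead. *)
pose P' := if x == o then [set o] else [set M; x].
have P'B : P' \subset block_set i 0.
  by rewrite /P'; case: ifP => _; rewrite ?subUset ?sub1set ?oB ?MB.
apply/esym; apply: (@exchange i 0 [set M] P' m) => //.
- by rewrite sub1set.
- by apply: sto; rewrite ?sub1set // inE.
- by apply: stM; rewrite ?subsetDl // !inE eqxx.
- by rewrite inE.
- by rewrite inE.
- by move=> v; rewrite inE => /eqP->.
- rewrite /P'; case: ifPn => xo.
    by apply: stM; rewrite ?sub1set // inE eq_sym.
  by apply: sto; rewrite ?subUset ?sub1set ?MB // !inE (negPf neqMo) eq_sym.
- rewrite /P'; case: ifPn => xo.
    by apply: sto; rewrite ?subsetDl // !inE eqxx.
  by apply: stM; rewrite ?subsetDl // !inE eqxx.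
- rewrite /P'; case: ifPn => xo; rewrite !inE; first by rewrite -(eqP xo) lt_eqF.
  by rewrite negb_or mneM lt_eqF.
- by rewrite /P'; case: ifPn => xo; rewrite !inE ?eqxx ?orbT.
- rewrite /P'; case: ifPn => xo v; rewrite !inE; first by rewrite (eqP xo) => /eqP->.
  by case/orP => /eqP->.
Qed.

(** Both values equal the value at the larger end. The indices [ua] and [ub] witness that [a] and
    [b] are not at the minimum of the window. *)
Lemma window_eq i a b ua ub :
  (i <= a <= i + al)%N -> (i <= b <= i + al)%N ->
  (i <= ua <= i + al)%N -> (i <= ub <= i + al)%N ->
  (w ua < w a)%O -> (w ub < w b)%O ->
  (w a <= w i)%O || (w a <= w (i + al))%O ->
  (w b <= w i)%O || (w b <= w (i + al))%O -> g (w a) = g (w b).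
Proof.
move=> ia ib iua iub uaa ubb.
have inW c : (i <= c <= i + al)%N -> w c \in block_set i 0.
  by move=> ic; apply/windowP; exists (c - i)%N; [natlia|rewrite subnKC //; natlia].
pose M := if (w i <= w (i + al))%O then (i + al)%N else i.
suff H c uc : (i <= c <= i + al)%N -> (i <= uc <= i + al)%N -> (w uc < w c)%O ->
    (w c <= w i)%O || (w c <= w (i + al))%O -> g (w c) = g (w M).
  by move=> aM bM; rewrite (H a ua) // (H b ub).
rewrite /M => ic iuc ucc cM; case: (leP (w i) (w (i + al))) cM => h cM.
  apply: (@window_eq_end i (w c) (w uc) al 0); rewrite ?addn0 //; first by right.
  - exact: inW.
  - exact: inW.
  - by case/orP: cM => // /le_trans; apply.
rewrite -[in RHS](addn0 i).
apply: (@window_eq_end i (w c) (w uc) 0 al); rewrite ?addn0 ?(ltW h) //; first by left.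
- exact: inW.
- exact: inW.
- by case/orP: cM => // /le_trans; apply; apply: ltW.
Qed.

(** * Propagation of equalities along the cyclic listing *)

Definition nonlow i := exists j, [/\ (i < j + al)%N, (j < i + al)%N & (w j < w i)%O].

(** The case analysis is on the side where the witnesses of [nonlow] lie. Either one window contains
    [i] and [i.+1] as non-minimal positions below its larger end, or an intermediate position [m]
    links two windows shifted by one. *)
Lemma g_consecutive i : (al <= i)%N -> nonlow i -> nonlow i.+1 -> g (w i) = g (w i.+1).
Proof.
move=> ali [u [iu ui lt_u]] [v [iv vi lt_v]].
have wne : w i != w i.+1.
  by have := @w_neq i 0 1; rewrite addn0 addn1; apply; natlia.
pose l := (i.+1 - al)%N; have lE : (l + al)%N = i.+1 by rewrite /l; natlia.
have [lt_yz|lt_zy|eq_yz] := ltgtP (w i) (w i.+1); last by rewrite eq_yz eqxx in wne.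
- have [ltui|leiu] := ltnP u i.
    apply: (@window_eq l i i.+1 u i); rewrite ?lE ?lexx ?(ltW lt_yz) ?orbT //; natlia.
  have {leiu} ltiu : (i.+1 < u)%N.
    rewrite ltn_neqAle; apply/andP; split; last first.
      by rewrite ltn_neqAle leiu andbT; apply: contraTneq lt_u => ->; rewrite ltxx.
    by apply: contraTneq lt_u => <-; rewrite lt_gtF.
  have lt_uz := lt_trans lt_u lt_yz.
  have [le_zt|lt_tz] := leP (w i.+1) (w (i + al)).
    apply: (@window_eq i i i.+1 u u); rewrite ?lexx ?le_zt ?orbT //; natlia.
  have une : w u != w (i + al).
    by have := @w_neq i (u - i) al; rewrite subnKC; [apply; natlia|natlia].
  (* Both ends of the window starting at [i] are below [w i.+1] here. The larger of [w u] and
     [w (i + al)] is the link and the smaller one shows that it is not minimal; both positions also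
     lie in the window starting at [i.+1]. *)
  pose m := if (w u < w (i + al))%O then (i + al)%N else u.
  pose m' := if (w u < w (i + al))%O then u else (i + al)%N.
  have [mm' mz mt um] : [/\ (w m' < w m)%O, (w m < w i.+1)%O,
      (w m <= w i)%O || (w m <= w (i + al))%O & (i.+1 < m <= i + al)%N && (i.+1 < m' <= i + al)%N].
    rewrite /m /m'; case: ifPn => h; split; rewrite ?lexx ?orbT ?(ltW lt_u) //; try natlia.
    by rewrite lt_neqAle eq_sym une leNgt.
  apply: (@etrans _ _ (g (w m))).
    apply: (@window_eq i i m u m'); rewrite ?lexx //; natlia.
  apply: (@window_eq i.+1 m i.+1 m' u); rewrite ?lexx ?(ltW mz) //; natlia.
- have [ltiv|leiv] := ltnP i.+1 v.
    apply: (@window_eq i i i.+1 i.+1 v); rewrite ?lexx ?(ltW lt_zy) //; natlia.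
  have {leiv} ltvi : (v < i)%N.
    rewrite ltn_neqAle; apply/andP; split.
      by apply: contraTneq lt_v => ->; rewrite lt_gtF.
    by rewrite -ltnS ltn_neqAle leiv andbT; apply: contraTneq lt_v => ->; rewrite ltxx.
  have lt_vy := lt_trans lt_v lt_zy.
  have [le_yt|lt_ty] := leP (w i) (w l).
    apply: (@window_eq l i i.+1 v v); rewrite ?lE ?lexx ?le_yt ?orbT //; natlia.
  have vne : w v != w l.
    by have := @w_neq l (v - l) 0; rewrite addn0 subnKC; [apply; natlia|natlia].
  (* The mirror image, with the windows ending at [i] and at [i.+1]. *)
  pose m := if (w v < w l)%O then l else v.
  pose m' := if (w v < w l)%O then v else l.
  have [mm' my mt um] : [/\ (w m' < w m)%O, (w m < w i)%O,
      (w m <= w l)%O || (w m <= w i.+1)%O & (l <= m < i)%N && (l <= m' < i)%N].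
    rewrite /m /m'; case: ifPn => h; split; rewrite ?lexx ?orbT ?(ltW lt_v) //; try natlia.
    by rewrite lt_neqAle eq_sym vne leNgt.
  pose l1 := (i - al)%N; have l1E : (l1 + al)%N = i by rewrite /l1; natlia.
  apply: (@etrans _ _ (g (w m))).
    apply: (@window_eq l1 i m v m'); rewrite ?l1E ?lexx ?(ltW my) ?orbT //; natlia.
  apply: (@window_eq l m i.+1 m' v); rewrite ?lE ?lexx ?orbT //; natlia.
Qed.

(** Since [al] is at least 2, three consecutive positions fit in a window; it is placed so that the
    larger of the two outer vertices is one of its ends. *)
Lemma g_valley i : (al <= i.+2)%N -> (w i.+1 < w i)%O -> (w i.+1 < w i.+2)%O ->
  g (w i) = g (w i.+2).
Proof.
move=> ali lt1 lt2; have [le20|lt02] := leP (w i.+2) (w i).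
  by apply: (@window_eq i i i.+2 i.+1 i.+1); rewrite ?lexx ?le20 //; natlia.
pose l := (i.+2 - al)%N; have lE : (l + al)%N = i.+2 by rewrite /l; natlia.
by apply: (@window_eq l i i.+2 i.+1 i.+1); rewrite ?lE ?lexx ?(ltW lt02) ?orbT //; natlia.
Qed.

(** A position that is not [nonlow] lies strictly below both of its neighbors, so it forms a valley
    that can be jumped over; otherwise the walk advances by one. *)
Lemma g_nonlow i n : (al <= i)%N -> nonlow i -> nonlow (i + n) -> g (w (i + n)) = g (w i).
Proof.
move=> ali Ni; elim/ltn_ind: n => -[|n] IHn; first by rewrite addn0.
rewrite addnS => Nn; have [Nn'|Nn'] := pselect (nonlow (i + n)).
  by rewrite -(IHn n) //; apply/esym/g_consecutive => //; natlia.
case: n IHn Nn Nn' => [|n] IHn Nn Nn'; first by rewrite addn0 in Nn'.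
have low j : (i + n.+1 < j + al)%N -> (j < i + n.+1 + al)%N -> (w (i + n.+1) <= w j)%O.
  by move=> ij ji; rewrite leNgt; apply/negP => lt; apply: Nn'; exists j.
have lt1 : (w (i + n).+1 < w (i + n))%O.
  rewrite lt_neqAle -addnS low ?andbT; try natlia.
  by have := @w_neq (i + n) 1 0; rewrite addn0 addn1 addnS; apply; natlia.
have lt2 : (w (i + n).+1 < w (i + n).+2)%O.
  rewrite lt_neqAle -addnS low ?andbT; try natlia.
  by have := @w_neq (i + n) 1 2; rewrite addn1 addn2 addnS; apply; natlia.
rewrite addnS -(IHn n) //; last by exists (i + n).+1; split=> //; natlia.
by apply/esym/g_valley => //; natlia.
Qed.

(** A vertex whose earlier non-neighbors are all far away in the listing is low, so each vertex is
    first traded for a [nonlow] position with the same value. That position can be taken beyond any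
    bound [b], which lets the two walks be ordered. *)
Lemma g_const v v' : v \in U -> v' \in U ->
  (exists u, [/\ u \in U, (u < v)%O & ~~ e u v]) ->
  (exists u, [/\ u \in U, (u < v')%O & ~~ e u v']) -> g v = g v'.
Proof.
suff H x : x \in U -> (exists u, [/\ u \in U, (u < x)%O & ~~ e u x]) ->
    forall b, exists i, [/\ (b <= i)%N, nonlow i & g x = g (w i)].
  move=> vU v'U /(H _ vU)/(_ al)[i [ali Ni ->]] /(H _ v'U)/(_ i)[j [ij Nj ->]].
  by rewrite -(subnKC ij); apply/esym/g_nonlow => //; rewrite subnKC.
move=> xU [u [uU ux uxe]] b.
have [t _ xE] := w_surj (al + b) xU; set i := (al + b + t)%N in xE.
have [s sq uE] := w_surj i uU.
case: s sq uE => [|s] sq uE; first by rewrite -uE addn0 xE ltxx in ux.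
pose j := (s %/ al)%N; have jk : (j < k)%N by rewrite ltn_divLR; natlia.
have sE : s = (j * al + s %% al)%N by apply: divn_eq.
have sal : (s %% al < al)%N by rewrite ltn_pmod; natlia.
have uB : u \in block_set i j by rewrite -uE sE; apply: block_set_wS.
have [m mB mmin] := exists_min uB.
(* All vertices of the block set other than [x] lie within distance less than [al] of each other, so
   the minimum [m] makes each of them [nonlow] except itself. *)
have nlw y : y \in block_set i j -> y != x -> y != m ->
    exists i', [/\ (b <= i')%N, nonlow i' & y = w i'].
  move=> yB yx ym; have [yE|[r ral yE]] := block_setP jk yB.
    by rewrite yE xE eqxx in yx.
  have [mE|[r' ral' mE]] := block_setP jk mB.
    by have := mmin _ uB; rewrite mE xE leNgt ux.
  exists (i + (j * al + r).+1)%N; split=> //; first by rewrite /i; natlia.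
  exists (i + (j * al + r').+1)%N; split; try natlia.
  by rewrite -yE -mE lt_neqAle eq_sym ym mmin.
have xB : x \in block_set i j by rewrite -xE block_set_w.
have mx : (m < x)%O := le_lt_trans (mmin _ uB) ux.
have block_stable : stable e (block_set i j :\ x).
  move=> y z /setD1P[yx yB] /setD1P[zx zB].
  have [yE|[r ral yE]] := block_setP jk yB; first by rewrite yE xE eqxx in yx.
  have [zE|[r' ral' zE]] := block_setP jk zB; first by rewrite zE xE eqxx in zx.
  by rewrite yE zE; apply: w_stable_dist; natlia.
have st1 y : stable e [set y] by move=> a c /set1P-> /set1P->; rewrite e_irr.
have st2 : stable e [set x; u].
  by move=> a c /set2P[]-> /set2P[]->; rewrite ?e_irr // e_sym.
have sub_stable (P P' : {set V}) : P \subset P' -> stable e P' -> stable e P.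
  by move=> /subsetP PP' st a c /PP' ? /PP' ?; apply: st.
have mnx : m \notin [set x] by rewrite inE lt_eqF.
have xmin : {in [set x], forall y, (x <= y)%O} by move=> y /set1P->.
have exch (P : {set V}) y := @exchange i j [set x] P m x y jk mB mmin.
(* The splitting that isolates [x] is compared with one that isolates [[set x; u]], whose minimum is
   [u]. If [u] is the overall minimum [m], the pair becomes the part of [m], and the exchanged
   minimum is that of the other part. *)
have [um|um] := eqVneq u m; last first.
  have [i' [bi Ni' uE']] := nlw u uB (negbT (lt_eqF ux)) um.
  exists i'; split=> //; rewrite -uE'; apply: (exch [set x; u]); rewrite ?set11 //.
  - by rewrite sub1set.
  - by rewrite subUset !sub1set xB.
  - by apply: sub_stable block_stable; rewrite setDS // sub1set !inE eqxx.
  - by rewrite !inE negb_or lt_eqF //= eq_sym.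
  - by rewrite !inE eqxx orbT.
  - by move=> y /set2P[]->; rewrite ?(ltW ux).
have [y yP ymin] : exists2 y, y \in block_set i j :\: [set x; u] &
    {in block_set i j :\: [set x; u], forall z, (y <= z)%O}.
  (* An offset 0 or 1 different from that of [u], available because [al] exceeds 1; it shows that
     the other part is nonempty. *)
  pose r := (s %% al == 0)%N : nat.
  have ral : (r < al)%N by rewrite /r; case: eqP; natlia.
  apply: (@exists_min _ (w (i + (j * al + r).+1))).
  have jq : (j * al + al < q)%N by rewrite qE ltnS -mulSnr mulnC leq_mul2l jk orbT.
  rewrite in_setD in_set2 block_set_wS // andbT negb_or -{1}xE -uE.
  apply/andP; split; apply/eqP.
    by rewrite -[in RHS](addn0 i) => /w_inj; natlia.
  move=> /w_inj H; have := H ltac:(natlia) sq.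
  by rewrite {1}sE /r; case: eqP; natlia.
have /setDP[yB] := yP; rewrite in_set2 negb_or => /andP[yx yu].
rewrite um in yu; have [i' [bi Ni' yE]] := nlw y yB yx yu.
exists i'; split=> //; rewrite -yE.
apply: (exch (block_set i j :\: [set x; u])); rewrite ?set11 //.
- by rewrite sub1set.
- by rewrite subsetDl.
- by apply: sub_stable block_stable; rewrite setDS // sub1set !inE eqxx.
- apply: sub_stable st2; rewrite setDDr setDv set0U; apply: subsetIr.
- by rewrite in_setD negb_and negbK in_set2 um eqxx orbT.
Qed.
End Cyclic.

(** * Colorings, 0/1 points and validity *)

Lemma colorable_widen (T : finType) (e : rel T) k k' :
  (k <= k')%N -> colorable e k -> colorable e k'.
Proof.
move=> kk' /existsP[f /forallP fP]; apply/existsP.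
exists [ffun x => widen_ord kk' (f x)]; apply/forallP => x; apply/forallP => y.
by rewrite !ffunE; have /forallP/(_ y) := fP x.
Qed.

Lemma chi_spec (T : finType) (e : rel T) : irreflexive e ->
  colorable e (chi e) /\ forall k, colorable e k -> (chi e <= k)%N.
Proof.
move=> e_irr; rewrite /chi.
case: (@arg_minnP _ (ord_max : 'I_#|T|.+1) (fun k : 'I_#|T|.+1 => colorable e k) id) => [|i ci imin].
  apply/existsP; exists [ffun x => enum_rank x].
  apply/forallP => x; apply/forallP => y; rewrite !ffunE; apply/implyP => exy.
  by rewrite (inj_eq enum_rank_inj); apply: contraTneq exy => ->; rewrite e_irr.
(* The minimum in [chi] ranges over ordinals up to [#|T|]; larger [k] are treated apart. *)
split=> // k ck; case: (leqP #|T|.+1 k) => kT.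
  by apply: leq_trans (ltnW kT); rewrite -ltnS.
exact: (imin (Ordinal kT)).
Qed.

(** * Colorings of induced subgraphs *)

Section Induced.
Context (T : finType) (e : rel T) (e_irr : irreflexive e).

Let induced_irr A : irreflexive (induced e A).
Proof. by move=> x; apply: e_irr. Qed.

Lemma chi_coloring (A : {set T}) : exists2 col : T -> nat,
  proper_on e A col & forall v, v \in A -> (col v < chi (induced e A))%N.
Proof.
have [/existsP[f /forallP fP] _] := chi_spec (@induced_irr A).
exists (fun v => if insub v is Some x then f x : nat else 0%N).
  move=> x y xA yA exy; rewrite !insubT.
  by have /forallP/(_ (Sub y yA)) := fP (Sub x xA); rewrite /induced /= exy.
by move=> v vA; rewrite insubT ltn_ord.
Qed.

Lemma chi_le (A : {set T}) k (col : T -> nat) : proper_on e A col ->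
  (forall v, v \in A -> (col v < k)%N) -> (chi (induced e A) <= k)%N.
Proof.
move=> colP colk; apply: (chi_spec (@induced_irr A)).2; apply/existsP.
exists [ffun x : {x | x \in A} => Ordinal (colk _ (valP x))].
apply/forallP => x; apply/forallP => y; rewrite !ffunE; apply/implyP => exy.
by rewrite -val_eqE; apply: colP exy; apply: valP.
Qed.

Lemma chi_le_image (A : {set T}) (S : finType) (col : T -> S) :
  proper_on e A col -> (chi (induced e A) <= #|col @: A|)%N.
Proof.
move=> colP; apply: (@chi_le _ _ (fun v => index (col v) (enum (col @: A)))) => [x y xA yA exy|v vA].
  apply: contra (colP _ _ xA yA exy) => /eqP/(congr1 (nth (col x) (enum (col @: A)))).
  by rewrite !nth_index ?mem_enum ?imset_f // => ->.
by rewrite cardE index_mem mem_enum imset_f.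
Qed.

(** Deleting a vertex of [induced e A] gives a subtype of a subtype; the coloring is carried back to
    [T], with the irrelevant default 0 elsewhere. *)
Lemma critical_coloring (A : {set T}) v : v \in A -> chi_critical (induced e A) ->
  exists2 col : T -> nat, proper_on e (A :\ v) col &
    forall u, u \in A :\ v -> (col u < (chi (induced e A)).-1)%N.
Proof.
move=> vA /(_ (Sub v vA)); set e' := induced _ [set~ _] => chi_lt.
have e'_irr : irreflexive e' by move=> x; apply: e_irr.
have chi_le : (chi e' <= (chi (induced e A)).-1)%N by rewrite -ltnS (ltn_predK chi_lt).
have /existsP[f /forallP fP] := colorable_widen chi_le (chi_spec e'_irr).1.
pose f' (x : {x | x \in A}) :=
  if insub x : {? x | x \in [set~ Sub v vA]} is Some y then f y : nat else 0%N.
exists (fun u => if insub u is Some x then f' x else 0%N).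
  move=> x y /setD1P[xv xA] /setD1P[yv yA] exy; rewrite !insubT /f'.
  have xS : Sub x xA \in [set~ Sub v vA : {x | x \in A}] by rewrite !inE -val_eqE.
  have yS : Sub y yA \in [set~ Sub v vA : {x | x \in A}] by rewrite !inE -val_eqE.
  rewrite !insubT.
  apply/eqP => /ord_inj/eqP; apply/negP.
  suff fP' X Y : e' X Y -> f X != f Y by apply: fP'.
  by have /forallP/(_ Y)/implyP := fP X.
move=> u /setD1P[uv uA]; rewrite insubT /f'.
have uS : Sub u uA \in [set~ Sub v vA : {x | x \in A}] by rewrite !inE -val_eqE.
by rewrite insubT ltn_ord.
Qed.
End Induced.

(** * 0/1 solutions as combinatorial systems, and validity *)

Section Points.
Context (d : Order.disp_t) (V : finOrderType d) (e : rel V).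
Hypotheses (e_sym : symmetric e) (e_irr : irreflexive e).
Context (R : realType) (p : V -> nat).
Implicit Types (X : V -> V -> bool) (U : {set V}).

Lemma aNm_aNp u w : (u \in aNm e w) = (w \in aNp e u).
Proof. by rewrite !inE e_sym. Qed.

Lemma aNm_irr w : w \in aNm e w = false.
Proof. by rewrite inE ltxx. Qed.

Definition point (Y : R) X : rep_space e R :=
  (Y, [ffun i => (X (val i).1 (val i).2)%:R]).

Lemma xval_point Y X u w :
  xval (point Y X) u w = (is_xvar e (u, w) && X u w)%:R.
Proof. by rewrite /xval; case: insubP => [i -> iE|/negPf->//]; rewrite ffunE iE. Qed.

(** The combinatorial content of (C1)-(C3): every non-source is represented, only sources and
    self-represented vertices represent others, and the vertices represented by one vertex are
    pairwise non-adjacent. *)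
Definition system X : Prop :=
  [/\ forall w, w \notin srcs e -> exists2 u, u \in w |: aNm e w & X u w,
      forall w u, u \in aNp e w -> X w u -> (w \in srcs e) || X w w
    & forall w u v, u \in aNp e w -> v \in aNp e w -> X w u -> X w v -> ~~ e u v].

Lemma repclique_pair w u v : u \in aNp e w -> v \in aNp e w -> e u v ->
  [set u; v] \in repcliques e w.
Proof.
move=> uw vw euv; have uv : u != v by apply: contraTneq euv => ->; rewrite e_irr.
rewrite inE cards2 uv subUset !sub1set uw vw /= andbT; apply/orP; left.
apply/forall_inP => x xK; apply/forall_inP => y yK; apply/implyP.
by move: xK yK => /set2P[]-> /set2P[]->; rewrite ?eqxx // e_sym.
Qed.

(** If [u] has a neighbor among the later anti-neighbors of [w], that edge is a clique of size 2;
    otherwise [[set u]] is maximal. Hence (C2) bounds every single [x_wu] by [x_ww]. *)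
Lemma repclique_cover w u : u \in aNp e w -> exists2 K, K \in repcliques e w & u \in K.
Proof.
move=> uw; have [/exists_inP[v vw euv]|] := boolP [exists v in aNp e w, e u v].
  exists [set u; v]; last by rewrite !inE eqxx.
  exact: repclique_pair.
rewrite negb_exists_in => /forall_inP iso.
exists [set u]; last by rewrite inE.
rewrite inE cards1 eqxx andbT; apply/orP; right.
have cl1 : is_clique e [set u].
  apply/forall_inP => x /set1P->; apply/forall_inP => y /set1P->.
  by rewrite eqxx.
apply/maxsetP; rewrite sub1set uw cl1; split=> // K /andP[/subsetP Kw /forall_inP clK].
rewrite sub1set => uK; apply/eqP; rewrite eqEsubset sub1set uK andbT.
apply/subsetP => v vK; rewrite inE; apply: contraT => vu.
have /forall_inP/(_ v vK) := clK u uK; rewrite eq_sym vu /= => euv.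
by have := iso v (Kw v vK); rewrite euv.
Qed.

Lemma repclique_sub w K : K \in repcliques e w -> K \subset aNp e w /\ is_clique e K.
Proof.
by rewrite inE => /orP[/and3P[-> ->]//|/andP[/maxsetP[/andP[-> ->]]]].
Qed.

(** The total weight bounds the left-hand sides of (C4) and (C5), so a large [Y] leaves only the
    conditions of [system]. *)
Lemma point_feasible Y X : \sum_v (p v)%:R <= Y -> system X ->
  feasible_01 p (point Y X).
Proof.
move=> pY [cover rep stab].
have x_ge0 u w : 0 <= xval (point Y X) u w by rewrite xval_point ler0n.
have x_le1 u w : xval (point Y X) u w <= 1 by rewrite xval_point lern1 leq_b1.
have clique_sum w K : K \in repcliques e w ->
    \sum_(u in K) xval (point Y X) w u <= ((w \in srcs e) || X w w)%:R.
  move=> /repclique_sub[/subsetP Kw /forall_inP clK].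
  have [/exists_inP[u uK Xwu]|] := boolP [exists u in K, X w u]; last first.
    rewrite negb_exists_in => /forall_inP H; rewrite big1 ?ler0n // => u uK.
    by rewrite xval_point (negPf (H u uK)) andbF.
  rewrite (bigD1 u) //= big1 ?addr0 => [|v /andP[vK vu]].
    by rewrite xval_point (rep w u) ?Kw // lern1 leq_b1.
  rewrite xval_point; case: (boolP (X w v)) => [Xwv|]; rewrite ?andbF //.
  have := stab _ _ _ (Kw _ uK) (Kw _ vK) Xwu Xwv.
  by have /forall_inP/(_ v vK) := clK u uK; rewrite eq_sym vu /= => ->.
have psum w (x : R) : 0 <= x <= 1 ->
    (p w)%:R * x + \sum_(u in aNp e w) (p u)%:R * xval (point Y X) w u <= Y.
  move=> /andP[x0 x1]; apply: le_trans pY; rewrite [leRHS](bigD1 w) //=.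
  apply: lerD; first by rewrite ler_piMr ?ler0n.
  rewrite [leRHS](bigID [pred u | u \in aNp e w]) /= -[leLHS]addr0; apply: lerD.
    rewrite [leRHS](eq_bigl [pred u | u \in aNp e w]) => [|u] /=.
      by apply: ler_sum => u _; rewrite ler_piMr ?ler0n.
    by rewrite inE; case: eqP => // ->; rewrite ltxx.
  by apply: sumr_ge0 => u _; rewrite ler0n.
split=> [|i|].
- by apply: le_trans pY; apply: sumr_ge0 => v _; rewrite ler0n.
- by rewrite ffunE; case: (X _ _); [right|left].
split=> [w wS|w K _ wS KR|w K _ wS KR|w wS|w wS].
- have [u uw Xuw] := cover w wS.
  rewrite (bigD1 u) //= xval_point Xuw andbT.
  have -> : is_xvar e (u, w).
    by move: uw; rewrite !inE /is_xvar /= wS andbT inE orbC.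
  by rewrite lerDl; apply: sumr_ge0.
- apply: le_trans (clique_sum w K KR) _.
  by rewrite xval_point /is_xvar /= eqxx (negPf wS) /= orbT.
- by apply: le_trans (clique_sum w K KR) _; rewrite wS.
- by apply: psum; rewrite x_ge0 x_le1.
- by have := psum w 1; rewrite mulr1; apply; rewrite ler01 lexx.
Qed.

Lemma point_in_polytope Y X : \sum_v (p v)%:R <= Y -> system X ->
  rep_polytope e R p (point Y X).
Proof.
move=> pY sX; exists 1%N, (fun=> 1), (fun=> point Y X); split=> //.
- by rewrite big_ord1.
- by move=> _; apply: point_feasible.
- by rewrite big_ord1 scale1r.
Qed.

Lemma feasible_system (z : rep_space e R) : feasible_01 p z ->
  (forall u w, xval z u w = 0 \/ xval z u w = 1) /\
  system (fun u w => xval z u w == 1).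
Proof.
move=> [_ z01 [C1 C2 C3 _ _]].
have x01 u w : xval z u w = 0 \/ xval z u w = 1.
  by rewrite /xval; case: insubP => [i _ _|_]; [apply: z01|left].
have x_ge0 u w : 0 <= xval z u w by case: (x01 u w) => ->.
split=> //; split=> [w wS|w u uw /eqP xwu|w u v uw vw /eqP xwu /eqP xwv].
- apply/exists_inP; apply: contraT; rewrite negb_exists_in => /forall_inP H.
  have := C1 w wS; rewrite big1 ?ler10 // => u uw.
  by case: (x01 u w) => // /eqP; rewrite (negPf (H u uw)).
- case: (boolP (w \in srcs e)) => //= wS.
  have wT : w \notin sinks e by rewrite inE; apply/set0Pn; exists u.
  have [K KR uK] := repclique_cover uw.
  have := C2 w K wT wS KR; rewrite (bigD1 u) //= xwu.
  case: (x01 w w) => ->; rewrite ?eqxx // => le0.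
  have : (1 : R) <= 0.
    by apply: le_trans le0; rewrite lerDl; apply: sumr_ge0.
  by rewrite ler10.
- apply/negP => euv; have KR := repclique_pair uw vw euv.
  have uv : u != v by apply: contraTneq euv => ->; rewrite e_irr.
  have wT : w \notin sinks e by rewrite inE; apply/set0Pn; exists u.
  have : \sum_(u0 in [set u; v]) xval z w u0 <= 1.
    case: (boolP (w \in srcs e)) => wS; first exact: C3.
    by apply: le_trans (C2 _ _ wT wS KR) _; case: (x01 w w) => ->.
  by rewrite big_setU1 ?inE // big_set1 xwu xwv -subr_ge0 opprD addrA subrr sub0r oppr_ge0 ler10.
Qed.

(** The map [rho] is a proper coloring of [U] whose colors are vertices of [U]. Each color lies in
    [srcs_in e U] or contributes at least 1 to the left-hand side. *)
Lemma ineq_valid U (z : rep_space e R) : feasible_01 p z ->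
  (chi (induced e U))%:R - #|srcs_in e U|%:R <= ineq_lhs e R U z.
Proof.
move=> /feasible_system[x01 [cover rep stab]].
pose own v := (v \in srcs_in e U) ||
  [exists u in v |: (aNm e v :\: U), xval z u v == 1].
pose rho v := if own v then v
  else odflt v [pick u | (u \in aNm e v :&: U) && (xval z u v == 1)].
have rhoP v : v \in U -> rho v = v /\ own v \/
    [/\ rho v \in aNm e v, rho v \in U & xval z (rho v) v = 1].
  move=> vU; rewrite /rho; case: ifPn => [|nown]; [by left|right].
  case: pickP => [u /andP[/setIP[-> ->] /eqP->//]|none].
  move: nown; rewrite negb_or negb_exists_in => /andP[vS /forall_inP H].
  have vnS : v \notin srcs e.
    move: vS; rewrite !inE vU /=; apply: contra => /eqP->.
    by rewrite set0I.
  have [u uv xuv] := cover v vnS; have := none u; rewrite xuv andbT.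
  case: (boolP (u \in v |: (aNm e v :\: U))) => [/H|]; first by rewrite xuv.
  by move: uv; rewrite !inE; case: eqP => //= _ ->; rewrite andbT negbK /= => ->.
have rho_proper : proper_on e U rho.
  (* If [rho v = rho v'], the two vertices coincide, one represents the other, or a third represents
     both; an edge is impossible in each case. *)
  move=> v v' vU v'U evv'; apply/eqP => rhoE.
  have := rhoP v vU; have := rhoP v' v'U; rewrite -rhoE.
  case=> [[r1 _]|[r1 _ x1]]; case=> [[r2 _]|[r2 _ x2]].
  - by move: evv'; rewrite -r1 r2 e_irr.
  - by move: r2; rewrite r1 inE e_sym evv' andbF.
  - by move: r1; rewrite r2 inE evv' andbF.
  - by have := stab (rho v) v v'; rewrite -!aNm_aNp r1 r2 x1 x2 eqxx evv' => /(_ isT isT isT isT).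
have own_rho v : v \in U -> own (rho v) && (rho v \in U).
  move=> vU; case: (rhoP v vU) => [[->->]//|[rv rU xv]]; rewrite rU andbT.
  (* A representative outside [srcs_in e U] is not a source, hence represents itself, and its
     diagonal variable is counted by the inequality. *)
  case: (boolP (rho v \in srcs_in e U)) => rS; first by rewrite /own rS.
  rewrite /own (negPf rS) /=; apply/exists_inP; exists (rho v); first by rewrite !inE eqxx.
  have := rep (rho v) v; rewrite -aNm_aNp rv xv eqxx => /(_ isT isT) /orP[|//].
  rewrite inE => /eqP S0; move: rS.
  by rewrite inE rU S0 set0I eqxx.
have := chi_le_image e_irr rho_proper.
set I := rho @: U => chiI.
pose W := [set v in U :\: srcs_in e U | [exists u in v |: (aNm e v :\: U), xval z u v == 1]].
have IW : I \subset srcs_in e U :|: W.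
  apply/subsetP => _ /imsetP[v vU ->]; have /andP[] := own_rho v vU.
  by rewrite /own in_setU => /orP[->//|ex] rU; rewrite [_ \in W]inE in_setD rU ex !andbT orbN.
have chiW : (chi (induced e U) <= #|srcs_in e U| + #|W|)%N.
  apply: leq_trans chiI (leq_trans (subset_leq_card IW) _).
  by rewrite cardsU leq_subr.
rewrite lerBlDl; apply: le_trans (_ : (#|srcs_in e U| + #|W|)%:R <= _).
  by rewrite ler_nat.
rewrite natrD lerD2l /ineq_lhs (bigID [pred v | v \in W]) /=.
rewrite -sum1_card natr_sum -[leLHS]addr0; apply: lerD; last first.
  by apply: sumr_ge0 => v _; apply: sumr_ge0 => u _; case: (x01 u v) => ->.
rewrite [leRHS](eq_bigl [pred v | v \in W]) => [|v] /=; last first.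
  by rewrite [v \in W]inE; case: (v \in U :\: _).
apply: ler_sum => v; rewrite inE => /andP[_ /exists_inP[u uv /eqP xuv]].
by rewrite (bigD1 u) //= xuv lerDl; apply: sumr_ge0 => t _; case: (x01 t v) => ->.
Qed.

Lemma ineq_valid_polytope U (z : rep_space e R) : rep_polytope e R p z ->
  (chi (induced e U))%:R - #|srcs_in e U|%:R <= ineq_lhs e R U z.
Proof.
move=> [k [a [s [a0 a1 As ->]]]]; set b := _ - _.
rewrite linear_sum /= -[b]mul1r -a1 mulr_suml; apply: ler_sum => i _.
by rewrite linearZ /= ler_wpM2l //; apply: ineq_valid.
Qed.
End Points.

(** * Linear forms that are constant on the face *)

Section FaceFunctional.
Context (d : Order.disp_t) (V : finOrderType d) (e : rel V).
Hypotheses (e_sym : symmetric e) (e_irr : irreflexive e).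
Context (R : realType) (p : V -> nat) (U : {set V}).
Implicit Types (r : V -> V).
Local Notation chiU := (chi (induced e U)).
Local Notation SU := (srcs_in e U).

(** * Representative maps and points on the face *)

Definition repmap r : Prop :=
  [/\ forall w, r w \in w |: aNm e w, forall w, r (r w) = r w
    & forall u v, r u = r v -> ~~ e u v].

Definition rep_system r (u w : V) : bool := u == r w.

Lemma repmap_system r : repmap r -> system e (rep_system r).
Proof.
move=> [rN rK rst]; split=> [w _|w u _ /eqP->|w u v _ _ /eqP wu /eqP wv].
- by exists (r w); rewrite ?rN /rep_system.
- by rewrite /rep_system rK eqxx orbT.
- by apply: rst; rewrite -wu.
Qed.

(** Since [a] represents nobody else, letting it also represent [b] creates no conflict; [b] is then
    represented twice, which (C1) allows. *)
Lemma repmap_add_system r a b : repmap r -> (forall w, r w = a -> w = a) ->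
  r a = a -> b \in aNp e a ->
  system e (fun u w => rep_system r u w || (u == a) && (w == b)).
Proof.
move=> [rN rK rst] single ra ab; split=> [w _|w u _|w u v uw vw].
- by exists (r w); rewrite ?rN /rep_system ?eqxx.
- case/orP => [/eqP->|/andP[/eqP-> _]]; apply/orP; right; apply/orP; left.
    by rewrite /rep_system rK.
  by rewrite /rep_system ra.
- have notr x : a = w -> x \in aNp e w -> rep_system r w x = false.
    move=> <- xa; apply/negP => /eqP/esym/single xE.
    by move: xa; rewrite xE inE ltxx.
  have [wa|wa] := eqVneq a w.
    by rewrite !notr //= => /eqP-> /eqP->; rewrite e_irr.
  rewrite /= !orbF => /eqP wu /eqP wv.
  by apply: rst; rewrite -wu.
Qed.

Lemma lhs_eq Y Y' (X X' : V -> V -> bool) :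
  (forall u v, v \in U :\: SU -> u \in v |: (aNm e v :\: U) -> X u v = X' u v) ->
  ineq_lhs e R U (point e Y X) = ineq_lhs e R U (point e Y' X').
Proof.
move=> XX'; apply: eq_bigr => v vU; apply: eq_bigr => u uv.
by rewrite !xval_point XX'.
Qed.

Definition repcount r : {set V} :=
  [set v in U :\: SU | (r v == v) || (r v \notin U)].

Lemma srcs_in_notin v : v \in U -> v \notin SU -> v \notin srcs e.
Proof. by move=> vU; rewrite !inE vU /=; apply: contra => /eqP->; rewrite set0I. Qed.

Lemma lhs_repmap Y r : repmap r ->
  ineq_lhs e R U (point e Y (rep_system r)) = #|repcount r|%:R.
Proof.
move=> [rN _ _]; rewrite /ineq_lhs (bigID [pred v | v \in repcount r]) /=.
rewrite [X in _ + X]big1 ?addr0 => [|v /andP[vU]]; last first.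
  rewrite [v \in repcount r]inE vU /= negb_or negbK => /andP[rv rU].
  rewrite big1 // => u; rewrite xval_point /rep_system !inE => uv.
  case: (u =P r v) => [uE|_]; last by rewrite andbF.
  by move: uv; rewrite uE (negPf rv) rU.
rewrite (eq_bigl [pred v | v \in repcount r]) => [|v] /=; last first.
  by rewrite [v \in repcount r]inE; case: (v \in U :\: _).
rewrite -sum1_card natr_sum; apply: eq_bigr => v; rewrite inE => /andP[/setDP[vU vS] rv].
have rin : r v \in v |: (aNm e v :\: U).
  by have := rN v; rewrite !inE; case/orP: rv => ->; rewrite ?andbT.
rewrite (bigD1 (r v)) //= big1 ?addr0 => [|u /andP[_ /negPf ur]].
  rewrite xval_point /rep_system eqxx andbT /is_xvar /= (srcs_in_notin vU vS) andbT.
  by have := rN v; rewrite 2!inE orbC => ->.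
by rewrite xval_point /rep_system ur andbF.
Qed.

Definition on_face r : Prop := repmap r /\ (#|repcount r| + #|SU|)%N = chiU.

(** Each color class of [U] is represented by its minimum, and the vertices outside [U] represent
    themselves, whatever [col] is there. *)
Definition class_rep (col : V -> nat) (w : V) : V :=
  if w \in U then [arg min_(u < w | (u \in U) && (col u == col w)) u]%O else w.

Section ClassRep.
Context (col : V -> nat) (col_proper : proper_on e U col).
Let r := class_rep col.

Lemma class_rep_out w : w \notin U -> r w = w.
Proof. by rewrite /r /class_rep => /negPf->. Qed.

Lemma class_repP w : w \in U ->
  [/\ r w \in U, col (r w) = col w & forall u, u \in U -> col u = col w -> (r w <= u)%O].
Proof.
move=> wU; rewrite /r /class_rep wU.
case: Order.TotalTheory.arg_minP => [|m /andP[mU /eqP mw] mmin]; first by rewrite wU eqxx.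
by split=> // u uU uw; apply: mmin; rewrite uU uw eqxx.
Qed.

Lemma class_rep_min w : w \in U -> (r w == w) = class_min U col w.
Proof.
move=> wU; have [rU cw rmin] := class_repP wU.
apply/eqP/forall_inP => [rw u uU|H].
  by apply/implyP => /eqP cu; rewrite -rw rmin.
apply/eqP; rewrite eq_le rmin //=.
by have := H _ rU; rewrite cw eqxx.
Qed.

Lemma class_rep_repmap : repmap r.
Proof.
have rU w : (r w \in U) = (w \in U).
  by case: (boolP (w \in U)) => [/class_repP[]//|wU]; rewrite class_rep_out ?(negPf wU).
have col_r w : w \in U -> col (r w) = col w by case/class_repP.
have e_out u v : u \in U -> v \in U -> col u = col v -> ~~ e u v.
  by move=> uU vU cuv; apply/negP => /(col_proper uU vU); rewrite cuv eqxx.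
split=> [w|w|u v].
- rewrite !inE; case: (boolP (w \in U)) => wU; last by rewrite class_rep_out ?eqxx.
  have [rwU cw rmin] := class_repP wU.
  by rewrite lt_neqAle rmin // e_out // !andbT orbN.
- case: (boolP (w \in U)) => wU; last by rewrite !class_rep_out // class_rep_out.
  have [rwU cw rmin] := class_repP wU; have [rrU crw rrmin] := class_repP rwU.
  by apply/eqP; rewrite eq_le rrmin //= rmin // crw.
- move=> ruv; case: (boolP (u \in U)) => uU.
    have vU : v \in U by rewrite -rU -ruv rU.
    by apply: e_out => //; rewrite -col_r // ruv col_r.
  have vU : v \notin U by rewrite -rU -ruv rU.
  by move: ruv; rewrite !class_rep_out // => ->; rewrite e_irr.
Qed.

(** The class minima number at most [chiU] because [col] is injective on them, and at least [chiU]
    because [r] is itself a proper coloring. Vertices of [SU] are always class minima, which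
    accounts for the term [#|SU|]. *)
Lemma class_rep_on_face : (forall v, v \in U -> (col v < chiU)%N) -> on_face r.
Proof.
move=> col_lt; have [rN rK rst] := class_rep_repmap; split=> //.
pose M := [set v in U | r v == v].
have SM : SU \subset M.
  apply/subsetP => v; rewrite !inE => /andP[vU /eqP Sv]; rewrite vU /=.
  have [rU _ _] := class_repP vU; apply: contraT => rv.
  suff : r v \in aNm e v :&: U by rewrite Sv inE.
  by rewrite inE rU andbT; have := rN v; rewrite in_setU1 (negPf rv).
have countE : repcount r = M :\: SU.
  apply/setP => v; rewrite [v \in repcount r]inE !in_setD [v \in M]inE.
  case: (boolP (v \in U)) => vU; rewrite ?andbF //.
  by have [-> _ _] := class_repP vU; rewrite orbF andbT.
rewrite countE cardsDS // subnK ?subset_leq_card //.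
apply/eqP; rewrite eqn_leq; apply/andP; split.
  have col_inj : {in M &, injective col}.
    move=> u v /setIdP[uU /eqP ru] /setIdP[vU /eqP rv] cuv.
    have [_ _ umin] := class_repP uU; have [_ _ vmin] := class_repP vU.
    by apply/eqP; rewrite eq_le -{1}ru umin //= -{1}rv vmin.
  apply: (card_le_nat _ col_inj) => v /setIdP[vU _]; exact: col_lt.
have : proper_on e U r.
  by move=> u v uU vU; apply: contraTneq; apply: rst.
move=> /(chi_le_image e_irr)/leq_trans; apply; apply: subset_leq_card.
by apply/subsetP => _ /imsetP[v vU ->]; rewrite inE rK eqxx andbT; case: (class_repP vU).
Qed.
End ClassRep.

(** Criticality colors [U :\ v] with one color fewer; the last color [chiU.-1] is reserved for
    [v]. *)
Lemma singleton_rep v : chi_critical (induced e U) -> v \in U ->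
  exists r, [/\ on_face r, r v = v, forall w, w \notin U -> r w = w,
    forall w, w \in U -> r w \in U & forall w, r w = v -> w = v].
Proof.
move=> crit vU; have [col colP col_lt] := critical_coloring e_irr vU crit.
have [chi0|chi0] := posnP chiU.
  have [c _ c_lt] := chi_coloring e_irr U.
  by have := c_lt v vU; rewrite chi0.
pose c w := if w == v then chiU.-1 else col w.
have c_lt w : w \in U -> w != v -> (c w < chiU.-1)%N.
  by move=> wU wv; rewrite /c (negPf wv) col_lt // !inE wv.
have cP : proper_on e U c.
  move=> x y xU yU exy; have [xv|xv] := eqVneq x v; have [yv|yv] := eqVneq y v.
  - by rewrite xv yv e_irr in exy.
  - by rewrite xv {1}/c eqxx gtn_eqF // c_lt.
  - by rewrite yv [c v]/c eqxx ltn_eqF // c_lt.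
  - by rewrite /c (negPf xv) (negPf yv) colP // !inE ?xv ?yv.
have cv w : w \in U -> c w = c v -> w = v.
  move=> wU cwv; apply/eqP; apply: contraT => wv.
  by have := c_lt _ wU wv; rewrite cwv /c eqxx ltnn.
exists (class_rep c); split.
- apply: class_rep_on_face => // w wU; have [->|wv] := eqVneq w v.
    by rewrite /c eqxx prednK.
  by apply: leq_trans (c_lt w wU wv) (leq_pred _).
- by have [rU crv _] := class_repP c vU; apply: cv.
- exact: class_rep_out.
- by move=> w /(class_repP c)[].
- move=> w rw; have wU : w \in U.
    by apply: contraT => wU; rewrite -rw class_rep_out ?(negPf wU) // in vU.
  by have [_ crw _] := class_repP c wU; apply: cv; rewrite // -crw rw.
Qed.

(** Vertices outside [U] are always alone in their class, so at most one of [a] and [b] has to be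
    isolated by criticality. *)
Lemma singleton_rep2 a b : chi_critical (induced e U) -> ~~ ((a \in U) && (b \in U)) ->
  exists r, [/\ on_face r, r a = a, r b = b,
    forall w, r w = a -> w = a & forall w, r w = b -> w = b].
Proof.
move=> crit; have out c v r : (forall w, w \notin U -> r w = w) ->
    (forall w, w \in U -> r w \in U) -> c \notin U -> r v = c -> v = c.
  move=> rout rin cU; case: (boolP (v \in U)) => [/rin rU rv|/rout->//].
  by rewrite -rv rU in cU.
case: (boolP (a \in U)) => aU /= bU.
  have [r [rf ra rout rin rs]] := singleton_rep crit aU; exists r; split=> //.
    exact: rout.
  by move=> w; apply: out.
case: (boolP (b \in U)) => {}bU.
  have [r [rf rb rout rin rs]] := singleton_rep crit bU; exists r; split=> //.
    exact: rout.
  by move=> w; apply: out.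
have [col colP col_lt] := chi_coloring e_irr U.
have rin w : w \in U -> class_rep col w \in U by move=> /(class_repP col)[].
exists (class_rep col); split; rewrite ?class_rep_out //; first exact: class_rep_on_face.
  by move=> w; apply: out => // ?; apply: class_rep_out.
by move=> w; apply: out => // ?; apply: class_rep_out.
Qed.

(** * Coefficients of a linear form constant on the face *)

Hypothesis crit : chi_critical (induced e U).
Context (phi : 'Hom(rep_space e R, R^o)) (C : R).
Hypothesis phi_face : forall z, rep_polytope e R p z ->
  ineq_lhs e R U z = chiU%:R - #|SU|%:R -> phi z = C.

Definition dirac (i : xvar e) : rep_space e R := (0, [ffun j => (j == i)%:R]).

(** Packing the coefficients into a point lets [xval] supply 0 for pairs that carry no variable. *)
Definition coef (u w : V) : R :=
  xval ((0, [ffun i => phi (dirac i)]) : rep_space e R) u w.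

Lemma coef0 u w : ~~ is_xvar e (u, w) -> coef u w = 0.
Proof. by rewrite /coef /xval; case: insubP => // i ->. Qed.

Lemma phiE z : phi z = z.1 * phi (1, 0) + \sum_w \sum_u xval z u w * coef u w.
Proof.
have {1}-> : z = z.1 *: ((1, 0) : rep_space e R) + \sum_i z.2 i *: dirac i.
  rewrite [LHS]surjective_pairing [RHS]surjective_pairing /=.
  have -> : (\sum_i z.2 i *: dirac i).1 = \sum_i z.2 i * 0 by rewrite (raddf_sum fst).
  have -> : (\sum_i z.2 i *: dirac i).2 = \sum_i z.2 i *: (dirac i).2 by rewrite (raddf_sum snd).
  congr (_, _).
    by rewrite big1 ?addr0 => [|i _]; rewrite ?mulr0 //; apply/esym/mulr1.
  apply/ffunP => j; rewrite scaler0 add0r sum_ffunE (bigD1 j) //= big1 ?addr0.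
    by rewrite !ffunE eqxx; apply/esym/mulr1.
  by move=> i ij; rewrite !ffunE eq_sym (negPf ij); apply: mulr0.
rewrite linearD linearZ linear_sum /=; congr (_ + _).
rewrite exchange_big pair_bigA (bigID (is_xvar e)) /= [X in _ = _ + X]big1 ?addr0; last first.
  by move=> [u w] /= /coef0->; rewrite mulr0.
rewrite (@reindex_omap _ _ _ _ (xvar e) val insub) => [|uw uwx]; last by rewrite insubT.
apply: eq_big => [i|i _]; first by rewrite (valP i) valK eqxx.
by rewrite linearZ /coef /xval -surjective_pairing valK ffunE.
Qed.

Local Notation psum := (\sum_v (p v)%:R : R).

Lemma phi_point Y X : phi (point e Y X) = Y * phi (1, 0) +
  \sum_w \sum_u (X u w)%:R * coef u w.
Proof.
rewrite phiE /=; congr (_ + _); apply: eq_bigr => w _; apply: eq_bigr => u _.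
by rewrite xval_point; case: (boolP (is_xvar e (u, w))) => // /coef0->; rewrite !mulr0.
Qed.

Lemma point_on_face Y X r : psum <= Y -> system e X -> on_face r ->
  (forall u v, v \in U :\: SU -> u \in v |: (aNm e v :\: U) -> X u v = rep_system r u v) ->
  phi (point e Y X) = C.
Proof.
move=> pY sX [rmap rcount] Xr; apply: phi_face; first exact: point_in_polytope.
by rewrite (lhs_eq Y Y Xr) lhs_repmap // -rcount natrD addrK.
Qed.

(** Raising [y] by 1 keeps a point with a large [y] in the polytope and on the face. *)
Lemma phi_y0 : phi (1, 0) = 0.
Proof.
have [col colP col_lt] := chi_coloring e_irr U.
have rf := class_rep_on_face colP col_lt; have sys := repmap_system rf.1.
have := point_on_face (lexx psum) sys rf (fun _ _ _ _ => erefl).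
have psum1 : psum <= psum + 1 by rewrite lerDl.
rewrite -(point_on_face psum1 sys rf) // !phi_point mulrDl mul1r => /eqP.
by rewrite -subr_eq0 opprD addrACA subrr addr0 opprD addrA subrr sub0r oppr_eq0 => /eqP.
Qed.

Lemma cost_on_face r : on_face r -> \sum_w coef (r w) w = C.
Proof.
move=> rf; rewrite -(point_on_face (lexx psum) (repmap_system rf.1) rf) //.
rewrite phi_point phi_y0 mulr0 add0r; apply: eq_bigr => w _.
rewrite (bigD1 (r w)) //= /rep_system eqxx mul1r big1 ?addr0 // => u /negPf->.
by rewrite mul0r.
Qed.

(* A vertex a forming a class by itself may moreover represent any later
   anti-neighbor b, which is already covered. *)
Lemma coef_zero a b : ~~ ((b \in U :\: SU) && (a \notin U)) -> a != b -> coef a b = 0.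
Proof.
move=> ab_out ab; case: (boolP (is_xvar e (a, b))) => [|/coef0//].
rewrite /is_xvar /= (negPf ab) /= orbF => aNb.
have [r [rf ra rs]] : exists r, [/\ on_face r, r a = a & forall w, r w = a -> w = a].
  have [aU|aU] := boolP (a \in U).
    by have [r [rf ra _ _ rs]] := singleton_rep crit aU; exists r.
  have [|r [rf ra _ rs _]] := @singleton_rep2 a b crit; last by exists r.
  by rewrite (negPf aU).
have := aNb; rewrite (aNm_aNp e_sym) => bNa.
(* The added variable [x_ab] is not counted by the inequality, so the new point stays on the
   face. *)
have same u v : v \in U :\: SU -> u \in v |: (aNm e v :\: U) ->
    rep_system r u v || (u == a) && (v == b) = rep_system r u v.
  move=> vU uv; case: (u =P a) => [ua|]; case: (v =P b) => [vb|]; rewrite ?andbF ?orbF //=.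
  move: ab_out; rewrite -vb vU /= negbK => aU.
  by move: uv; rewrite ua vb !inE aU (negPf ab).
have := point_on_face (lexx psum) (repmap_add_system rf.1 rs ra bNa) rf same.
rewrite -{1}(cost_on_face rf) phi_point phi_y0 mulr0 add0r.
have rb : r b != a by apply: contraNneq ab => /rs->.
rewrite (bigD1 b) //= [in RHS](bigD1 b) //=.
have -> : \sum_(w | w != b) \sum_u (rep_system r u w || (u == a) && (w == b))%:R * coef u w =
    \sum_(w | w != b) coef (r w) w.
  apply: eq_bigr => w /negPf wb; rewrite (bigD1 (r w)) //= /rep_system eqxx mul1r.
  by rewrite big1 ?addr0 // => u /negPf->; rewrite wb andbF mul0r.
rewrite (bigD1 (r b)) //= (bigD1 a) /=; last by rewrite eq_sym.
rewrite /rep_system !eqxx orbT !mul1r big1 ?addr0; last first.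
  by move=> u /andP[/negPf-> /negPf->]; rewrite mul0r.
by move=> /addIr/eqP; rewrite -subr_eq0 addrAC subrr add0r => /eqP.
Qed.

(* If a and b both form classes by themselves, then a may represent b. *)
Lemma coef_swap a b : a \in aNm e b -> ~~ ((a \in U) && (b \in U)) ->
  coef a b = coef b b.
Proof.
move=> aNb abU; have [r [rf ra rb sa sb]] := singleton_rep2 crit abU.
have [[rN rK rst] rcount] := rf.
have ab : a != b by apply: contraTneq aNb => ->; rewrite aNm_irr.
pose r' w := if w == b then a else r w.
have r'f : on_face r'.
  split; [split|].
  - move=> w; rewrite /r'; case: eqP => [->|_]; last exact: rN.
    by rewrite in_setU1 aNb orbT.
  - move=> w; rewrite {2 3}/r'; case: eqP => [_|wb]; first by rewrite /r' (negPf ab).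
    rewrite /r'; case: eqP => [/sb//|_]; exact: rK.
  - move=> u v; rewrite /r'; have neab : ~~ e a b by move: aNb; rewrite inE => /andP[].
    case: eqP => [->|ub]; case: eqP => [->|vb].
    + by rewrite e_irr.
    + by move=> /esym/sa->; rewrite e_sym.
    + by move=> /sa->.
    + exact: rst.
  (* If [b] is in [U], then [a] is not, so [b] counts equally when it represents itself and when [a]
     represents it. *)
  - rewrite -rcount; congr (#|pred_of_set _| + _)%N; apply/setP => v.
    rewrite [LHS]inE [RHS]inE /r'; case: (v =P b) => [->|//]; rewrite rb eqxx /=.
    rewrite in_setD; case: (boolP (b \in U)) => bU; rewrite ?andbF //.
    by move: abU; rewrite bU andbT => ->; rewrite orbT andbT.
have := cost_on_face rf; rewrite -(cost_on_face r'f) (bigD1 b) //= [in RHS](bigD1 b) //=.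
rewrite rb {1}/r' eqxx => /esym.
rewrite (eq_bigr (fun w => coef (r w) w)) => [/addIr//|w /negPf wb].
by rewrite /r' wb.
Qed.

(** A source has no diagonal variable. Otherwise [v] has an earlier anti-neighbor [u], not in [U] if
    [v] is; then [x_vv] and [x_uv] have equal coefficients, and that of [x_uv] is zero. *)
Lemma coef_diag0 v : v \notin U :\: SU -> coef v v = 0.
Proof.
move=> vU; case: (boolP (v \in srcs e)) => [vS|].
  by apply: coef0; rewrite /is_xvar /= vS aNm_irr andbF.
rewrite inE => /set0Pn[u uv].
have uvU : ~~ ((u \in U) && (v \in U)).
  apply/negP => /andP[uU vU']; move: vU; rewrite in_setD vU' andbT negbK [v \in SU]inE vU' => /eqP Sv.
  have : u \in aNm e v :&: U by rewrite in_setI uv.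
  by rewrite Sv inE.
rewrite -(coef_swap uv uvU) coef_zero ?(negPf vU) //.
by apply: contraTneq uv => ->; rewrite aNm_irr.
Qed.

(** Once the off-support coefficients vanish, the constant value on the face is carried by the class
    minima; this is the hypothesis [sum_min] of the cyclic exchange argument for [coef v v]. *)
Lemma coef_sum_min (col : V -> nat) : proper_on e U col ->
  (forall v, v \in U -> (col v < chiU)%N) ->
  \sum_(v in U | class_min U col v) coef v v = C.
Proof.
move=> colP col_lt; have rf := class_rep_on_face colP col_lt.
rewrite -(cost_on_face rf) big_mkcond /=; apply: eq_bigr => w _.
case: (boolP (w \in U)) => wU /=; last first.
  by rewrite class_rep_out // coef_diag0 // in_setD (negPf wU) andbF.
rewrite -class_rep_min //; case: eqP => [->//|/eqP rw].
by rewrite coef_zero // negb_and negbK; have [-> _ _] := class_repP col wU; rewrite orbT.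
Qed.

Lemma phi_multiple K : (forall v, v \in U :\: SU -> coef v v = K) ->
  forall z, phi z = K * ineq_lhs e R U z.
Proof.
move=> diagK z; rewrite phiE phi_y0 mulr0 add0r mulr_sumr.
rewrite (bigID [pred v | v \in U :\: SU]) /= [X in _ + X]big1 ?addr0; last first.
  move=> v vU; rewrite big1 // => u _; have [->|uv] := eqVneq u v.
    by rewrite coef_diag0 ?mulr0.
  by rewrite coef_zero ?mulr0 // (negPf vU).
apply: eq_bigr => v vU; rewrite mulr_sumr.
rewrite (bigID [pred u | u \in v |: (aNm e v :\: U)]) /= [X in _ + X]big1 ?addr0; last first.
  move=> u; rewrite in_setU1 negb_or in_setD negb_and negbK => /andP[uv uN].
  case/orP: uN => uN; first by rewrite coef_zero ?mulr0 // uN andbF.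
  by rewrite coef0 ?mulr0 // /is_xvar /= (negPf uN) (negPf uv).
apply: eq_bigr => u; rewrite in_setU1 mulrC => uv; congr (_ * _).
case/orP: uv => [/eqP->|/setDP[uv uU]]; first exact: diagK.
by rewrite coef_swap ?diagK // (negPf uU).
Qed.
End FaceFunctional.

(** * Critical webs and antiwebs *)

Lemma card_le_colors (T : finType) (e : rel T) (A : {set T}) (col : T -> nat) n m :
  proper_on e A col -> (forall v, v \in A -> (col v < n)%N) ->
  (forall B : {set T}, B \subset A -> stable e B -> (#|B| <= m)%N) ->
  (#|A| <= m * n)%N.
Proof.
move=> colP col_lt st_le.
have -> : #|A| = (\sum_(c < n) #|[set v in A | col v == c]|)%N.
  rewrite -sum1_card (partition_big (fun v => inord (col v) : 'I_n.-1.+1) predT) //=.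
  case: n col_lt => [|n] col_lt.
    rewrite big_ord0 big1 // => c _; rewrite big_pred0 // => v.
    by apply/negbTE/negP => /andP[/col_lt].
  apply: eq_bigr => c _; rewrite -sum1_card; apply: eq_bigl => v.
  rewrite !inE; case: (boolP (v \in A)) => //= vA.
  by rewrite -val_eqE /= inordK ?col_lt.
rewrite mulnC -[n in (n * _)%N]card_ord -sum_nat_const; apply: leq_sum => c _.
apply: st_le => [|x y /setIdP[xA /eqP cx] /setIdP[yA /eqP cy]].
  by apply/subsetP => v /setIdP[].
by apply/negP => /(colP _ _ xA yA); rewrite cx cy eqxx.
Qed.

Lemma min_index q (A : {set 'I_q}) : A != set0 ->
  exists2 a : 'I_q, a \in A & forall b, b \in A -> (a <= b)%N.
Proof.
case/set0Pn => x xA; case: (@arg_minnP _ x (mem A) val xA) => a aA amin.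
by exists a.
Qed.

(** Relative to the least element [a], every other element is at distance less than [l] or more than
    [q - l]. Folding the second range down by [q - l] maps into [l] values, and a collision would be
    an edge, of length exactly [q - l]. *)
Lemma web_stable_card q l (A : {set 'I_q}) : (2 <= l)%N -> (2 * l <= q)%N ->
  stable (web q l) A -> (#|A| <= l)%N.
Proof.
move=> l2 lq Ast; have [->|/min_index[a aA amin]] := eqVneq A set0; first by rewrite cards0.
have dist (x y : 'I_q) : x \in A -> y \in A -> (x <= y)%N -> (y - x < l)%N \/ (q - l < y - x)%N.
  move=> xA yA xy; have := Ast _ _ xA yA; rewrite /web; clear -xy; lia.
apply: (@card_le_nat _ _ (fun b : 'I_q => if (b - a < l)%N then (b - a)%N else (b - a - (q - l))%N)).
  move=> b bA; have := dist _ _ aA bA (amin _ bA); have := ltn_ord b.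
  case: ifP; clear -l2 lq; lia.
move=> b c bA cA /= H; apply: val_inj => /=; move: H.
have := dist _ _ aA bA (amin _ bA); have := dist _ _ aA cA (amin _ cA).
have := amin _ bA; have := amin _ cA.
have := dist _ _ bA cA; have := dist _ _ cA bA; have := ltn_ord b; have := ltn_ord c.
do 2 case: ifP; clear -l2 lq; lia.
Qed.

(** Elements are pairwise at least [l] apart and within [q - l] of the least one, so division by [l]
    separates them into at most [q %/ l] values. *)
Lemma antiweb_stable_card q l (A : {set 'I_q}) : (2 <= l)%N -> (2 * l <= q)%N ->
  stable (antiweb q l) A -> (#|A| <= q %/ l)%N.
Proof.
move=> l2 lq Ast; have [->|/min_index[a aA amin]] := eqVneq A set0; first by rewrite cards0.
have l0 : (0 < l)%N by apply: ltnW.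
have dist (x y : 'I_q) : x \in A -> y \in A -> (x < y)%N -> (l <= y - x <= q - l)%N.
  move=> xA yA xy; have := Ast _ _ xA yA; rewrite /antiweb /web -val_eqE /=; clear -xy; lia.
have quot_neq (b c : 'I_q) : b \in A -> c \in A -> (b < c)%N ->
    ((b - a) %/ l < (c - a) %/ l)%N.
  move=> bA cA bc; rewrite ltnNge; apply/negP => le_quot.
  have := dist _ _ bA cA bc; have := amin _ bA.
  have := divn_eq (c - a) l; have := divn_eq (b - a) l.
  have := ltn_pmod (c - a) l0; have := leq_mul2r l ((c - a) %/ l) ((b - a) %/ l).
  rewrite le_quot orbT; clear; set x := (_ * l)%N; set y := (_ * l)%N; lia.
apply: (@card_le_nat _ _ (fun b : 'I_q => (b - a) %/ l)%N) => [b bA|b c bA cA /= bcE].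
  apply: (@leq_trans ((q - l) %/ l).+1); last first.
    have lq' : (l <= q)%N by clear -lq; lia.
    by rewrite -[in leqRHS](subnK lq') divnDr // divnn l0 addn1.
  rewrite ltnS leq_div2r //; have [ab|] := ltnP a b; last by lia.
  by have /andP[] := dist _ _ aA bA ab.
apply: val_inj; case: (ltngtP b c) => // bc.
  by have := quot_neq _ _ bA cA bc; rewrite bcE ltnn.
by have := quot_neq _ _ cA bA bc; rewrite bcE ltnn.
Qed.

Lemma web_quotient_proper q l (i j : 'I_q) : (2 <= l)%N -> web q l i j -> (i %/ l != j %/ l)%N.
Proof.
move=> l2 wij; apply/eqP => ijE; move: wij.
have := same_quotient_lt (ltnW l2) ijE; have := same_quotient_lt (ltnW l2) (esym ijE).
rewrite /web; clear; lia.
Qed.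

Lemma modn_dist a D q : (D < q)%N ->
  ((a + D) %% q)%N = (a %% q + D)%N \/ ((a + D) %% q + q)%N = (a %% q + D)%N.
Proof.
move=> Dq; have q0 : (0 < q)%N by apply: leq_ltn_trans Dq.
have aq := ltn_pmod a q0; rewrite -modnDml.
have [lt|le] := ltnP (a %% q + D) q; first by left; rewrite modn_small.
right; rewrite -(subnK le) modnDr modn_small //; clear -aq Dq; lia.
Qed.

(** Indices at cyclic distance [c] with [0 < c < l] are sent by multiplication by [al] to cyclic
    distance [c * al], between [al] and [q - al]; hence they fall into different blocks of length
    [al]. The two cases are the two directions around the cycle. *)
Lemma close_mul_quotient x y q al l : (x < y < q)%N -> (0 < al)%N ->
  (al * l <= q)%N -> (y - x < l)%N \/ (q - l < y - x)%N ->
  ((x * al) %% q %/ al != (y * al) %% q %/ al)%N.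
Proof.
move=> /andP[xy yq] al0 alq dl; apply/eqP => E.
have h1 := same_quotient_lt al0 E; have h2 := same_quotient_lt al0 (esym E).
have le_mul c : (c < l)%N -> (c * al + al <= q)%N.
  by move=> cl; rewrite -mulSnr (leq_trans _ alq) // mulnC leq_mul2l cl orbT.
have [c dE] : exists c, y = (x + c)%N by exists (y - x)%N; rewrite subnKC // ltnW.
case: dl => dl.
  have cl : (c < l)%N by move: dl; rewrite dE addKn.
  have le1 : (al <= c * al)%N.
    by rewrite leq_pmull // lt0n; apply: contraTneq xy => c0; rewrite dE c0 addn0 ltnn.
  have le2 := le_mul _ cl.
  have cq : (c * al < q)%N by rewrite (leq_trans _ le2) // -addn1 leq_add2l.
  have := @modn_dist (x * al) (c * al) q cq; rewrite -mulnDl -dE.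
  clear - h1 h2 le1 le2; lia.
have [c' qE] : exists c', q = (c + c')%N.
  by exists (q - c)%N; rewrite subnKC //; clear - yq dE; lia.
have c'l : (c' < l)%N by clear - dl dE qE; lia.
have le1 : (al <= c' * al)%N.
  by rewrite leq_pmull //; clear - yq dE qE; lia.
have le2 := le_mul _ c'l.
have cq : (c' * al < q)%N by rewrite (leq_trans _ le2) // -addn1 leq_add2l.
have xyE : ((y * al + c' * al) %% q = (x * al) %% q)%N.
  by rewrite -mulnDl dE -addnA -qE mulnDl addnC (mulnC q) modnMDl.
have := @modn_dist (y * al) (c' * al) q cq; rewrite xyE.
clear - h1 h2 le1 le2; lia.
Qed.

Lemma antiweb_quotient_proper q l (i j : 'I_q) (al := (q %/ l)%N) :
  (2 <= l)%N -> (2 * l <= q)%N -> antiweb q l i j ->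
  ((i * al) %% q %/ al != (j * al) %% q %/ al)%N.
Proof.
move=> l2 lq; have l0 : (0 < l)%N by apply: ltnW.
have al0 : (0 < al)%N by rewrite divn_gt0 // (leq_trans _ lq) // leq_pmull.
have alq : (al * l <= q)%N by apply: leq_divM.
have H (x y : 'I_q) : (x < y)%N -> antiweb q l x y ->
    ((x * al) %% q %/ al != (y * al) %% q %/ al)%N.
  move=> xy xyA; apply: (@close_mul_quotient _ _ _ _ l) => //; first by rewrite xy /=.
  by move: xyA; rewrite /antiweb /web -val_eqE /=; clear -xy; lia.
move=> ijA; case: (ltngtP i j) => ij; first exact: H.
  by rewrite eq_sym H // /antiweb /web eq_sym; move: ijA; rewrite /antiweb /web distnC.
by move: ijA; rewrite /antiweb -val_eqE /= ij eqxx.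
Qed.

Lemma webD q l (q0 : (0 < q)%N) a D : (D < q)%N ->
  web q l (Ordinal (ltn_pmod a q0)) (Ordinal (ltn_pmod (a + D) q0)) =
    (l <= D <= q - l)%N || (l <= q - D <= q - l)%N.
Proof.
move=> Dq; rewrite /web /=; have := modn_dist a Dq; have := ltn_pmod a q0; have := ltn_pmod (a + D) q0.
move: ((a + D) %% q)%N (a %% q)%N => x y; clear -Dq; lia.
Qed.

(** * Number of vertices and cyclic labelling *)

Section Labelling.
Context (d : Order.disp_t) (V : finOrderType d) (e : rel V).
Hypotheses (e_sym : symmetric e) (e_irr : irreflexive e).
Context (U : {set V}) (q : nat) (W : rel 'I_q) (h : 'I_q -> V).
Hypotheses (h_in : forall i, h i \in U) (h_inj : injective h)
  (h_surj : forall v, v \in U -> exists i, h i = v)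
  (hW : forall i j, e (h i) (h j) = W i j).

(** Upper bound: a deleted vertex leaves [chi - 1] stable classes of size at most [al]. Lower bound:
    [colI] uses at most [q.-1 %/ al + 1] colors, so [chi - 1] is at most [q.-1 %/ al]. *)
Lemma critical_size al (colI : 'I_q -> nat) : (0 < q)%N ->
  chi_critical (induced e U) ->
  (forall A : {set 'I_q}, stable W A -> (#|A| <= al)%N) ->
  (forall i j, W i j -> colI i != colI j) -> (forall i, colI i <= q.-1 %/ al)%N ->
  q = (al * (chi (induced e U)).-1).+1.
Proof.
move=> q0 crit st_le colIP colI_le.
have UE : U = h @: setT.
  apply/setP => v; apply/idP/imsetP => [/h_surj[i <-]|[i _ ->//]]; by exists i.
have cardU : #|U| = q by rewrite UE card_imset // cardsT card_ord.
have [hV hVK] : exists hV : V -> 'I_q, forall i, hV (h i) = i.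
  exists (fun v => odflt (Ordinal q0) [pick i | h i == v]) => i.
  by case: pickP => [j /eqP/h_inj//|/(_ i)]; rewrite eqxx.
have h0U : h (Ordinal q0) \in U by apply: h_in.
have [col colP col_lt] := critical_coloring e_irr h0U crit.
apply/eqP; rewrite eqn_leq; apply/andP; split.
  have := cardsD1 (h (Ordinal q0)) U; rewrite h0U cardU add1n => ->.
  rewrite ltnS; apply: (card_le_colors colP col_lt) => B BU Bst.
  have -> : #|B| = #|[set i | h i \in B]|.
    rewrite -(card_imset _ h_inj); apply: eq_card => v; apply/idP/imsetP.
      move=> vB; have vU : v \in U by move/subsetP/(_ _ vB): BU => /setD1P[].
      by have [i iE] := h_surj vU; exists i; rewrite ?inE iE.
    by move=> [i]; rewrite inE => iB ->.
  by apply: st_le => i j; rewrite !inE -hW; apply: Bst.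
have chi_le : (chi (induced e U) <= (q.-1 %/ al).+1)%N.
  apply: (@chi_le _ _ e_irr U _ (fun v => colI (hV v))) => [x y xU yU|v _]; last by rewrite ltnS.
  have [i <-] := h_surj xU; have [j <-] := h_surj yU.
  by rewrite hW !hVK; apply: colIP.
rewrite -[leqRHS](prednK q0) ltnS mulnC; apply: leq_trans (leq_divM _ al).
by rewrite leq_mul2r -subn1 leq_subLR add1n chi_le orbT.
Qed.

(** The listing walks around the cycle in steps of [s]; the inverse [s'] of [s] modulo [q] makes
    each run of [q] steps visit every vertex once. *)
Lemma cyclic_labelling al s s' (q0 : (0 < q)%N) : ((s * s') %% q = 1 %% q)%N ->
  (forall a j, (0 < j < al)%N ->
     ~~ W (Ordinal (ltn_pmod a q0)) (Ordinal (ltn_pmod (a + j * s) q0))) ->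
  exists w : nat -> V, [/\ forall i, w i \in U,
    forall i v, v \in U -> exists2 t, (t < q)%N & w (i + t)%N = v,
    forall i t t', (t < q)%N -> (t' < q)%N -> w (i + t)%N = w (i + t')%N -> t = t'
    & forall i j, (i < j < i + al)%N -> ~~ e (w i) (w j)].
Proof.
move=> ss' Wst; exists (fun t => h (Ordinal (ltn_pmod (t * s) q0))).
have sK a : (a * s * s' = a %[mod q])%N.
  by rewrite -mulnA -modnMmr ss' modnMmr muln1.
split=> [i|i v /h_surj[j <-]|i t t' tq t'q|i j ij].
- exact: h_in.
(* Solves [(i + t) * s = j] modulo [q]: the term [i * q.-1] stands for [- i]. *)
- exists ((j * s' + i * q.-1) %% q)%N; first by rewrite ltn_pmod.
  congr h; apply: val_inj => /=.
  rewrite -modnMml modnDmr addnCA -mulnS prednK // addnC modnMDl modnMml mulnAC.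
  by rewrite sK modn_small.
- move=> /h_inj/(congr1 val)/= E.
  have : ((i + t) * s * s' = (i + t') * s * s' %[mod q])%N.
    by rewrite -modnMml E modnMml.
  by rewrite !sK => /eqP; rewrite eqn_modDl !modn_small // => /eqP.
- have [t tal ->] : exists2 t, (0 < t < al)%N & j = (i + t)%N by exists (j - i)%N; lia.
  rewrite hW; have := Wst (i * s)%N t tal; congr (~~ W _ _).
  by apply: val_inj; rewrite /= mulnDl.
Qed.
End Labelling.

Section CriticalWebs.
Context (d : Order.disp_t) (V : finOrderType d) (e : rel V).
Hypotheses (e_sym : symmetric e) (e_irr : irreflexive e).
Context (U : {set V}).

Definition cyclic_structure (al k : nat) (w : nat -> V) : Prop :=
  let q := (al * k).+1 in
  [/\ forall i, w i \in U,
      forall i v, v \in U -> exists2 t, (t < q)%N & w (i + t)%N = v,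
      forall i t t', (t < q)%N -> (t' < q)%N -> w (i + t)%N = w (i + t')%N -> t = t'
    & forall i j, (i < j < i + al)%N -> ~~ e (w i) (w j)].

Lemma iso_labelling q (W : rel 'I_q) : graph_iso (induced e U) W ->
  exists h : 'I_q -> V, [/\ forall i, h i \in U, injective h,
    forall v, v \in U -> exists i, h i = v & forall i j, e (h i) (h j) = W i j].
Proof.
move=> [f [g fK gK] fW]; exists (fun i => val (g i)); split=> [i|i j|v vU|i j].
- exact: valP.
- by move=> /val_inj/(can_inj gK).
- by exists (f (Sub v vU)); rewrite fK.
- by rewrite -[in RHS](gK i) -[in RHS](gK j) fW.
Qed.

Lemma web_structure : is_web (induced e U) -> chi_critical (induced e U) ->
  exists al k w, [/\ (1 < al)%N, (0 < k)%N, chi (induced e U) = k.+1 & cyclic_structure al k w].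
Proof.
move=> [q [l [l2 lq /iso_labelling[h [h_in h_inj h_surj hW]]]]] crit.
have q0 : (0 < q)%N by clear -l2 lq; lia.
have qE : q = (l * (chi (induced e U)).-1).+1.
  apply: (critical_size e_irr h_in h_inj h_surj hW (colI := fun i : 'I_q => (i %/ l)%N)) => //.
  - by move=> A; apply: web_stable_card.
  - by move=> i j; apply: web_quotient_proper.
  - by move=> i; rewrite leq_div2r // -ltnS prednK.
set k := (chi (induced e U)).-1 in qE.
have k0 : (0 < k)%N by rewrite lt0n; apply/eqP => k0; move: lq l2; rewrite qE k0; clear; lia.
have [|a j jl|w] := cyclic_labelling h_in h_inj h_surj hW (al := l) (s := 1) (s' := 1) (q0 := q0).
- by [].
- have jq : (j * 1 < q)%N by clear - jl lq; lia.
  by rewrite webD //; clear - jl lq; lia.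
by rewrite qE => wP; exists l, k, w; split=> //; rewrite /k in k0 *; case: chi k0.
Qed.

Lemma antiweb_structure : is_antiweb (induced e U) -> chi_critical (induced e U) ->
  exists al k w, [/\ (1 < al)%N, (0 < k)%N, chi (induced e U) = k.+1 & cyclic_structure al k w].
Proof.
move=> [q [l [l2 lq /iso_labelling[h [h_in h_inj h_surj hW]]]]] crit.
have q0 : (0 < q)%N by clear -l2 lq; lia.
have l0 : (0 < l)%N by apply: ltnW.
pose al := (q %/ l)%N; have al2 : (1 < al)%N by rewrite leq_divRL.
have alq : (al * l <= q)%N by apply: leq_divM.
have qE : q = (al * (chi (induced e U)).-1).+1.
  apply: (critical_size e_irr h_in h_inj h_surj hW
            (colI := fun i : 'I_q => ((i * al) %% q %/ al)%N)) => //.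
  - by move=> A; apply: antiweb_stable_card.
  - by move=> i j; apply: antiweb_quotient_proper.
  - by move=> i; rewrite leq_div2r // -ltnS prednK // ltn_pmod.
have [k kE] : exists k, (chi (induced e U)).-1 = k by exists (chi (induced e U)).-1.
rewrite kE in qE.
(* From [al * l <= q = al * k + 1] and [al > 1]. *)
have lk : (l <= k)%N.
  rewrite leqNgt; apply/negP => kl.
  have : (al * k.+1 <= al * l)%N by rewrite leq_mul2l kl orbT.
  by move: alq; rewrite qE mulnS; clear - al2; lia.
have k0 : (0 < k)%N by apply: leq_trans lk.
have [|a j jl|w] := cyclic_labelling h_in h_inj h_surj hW (al := al) (s := k) (s' := (q - al)%N) (q0 := q0).
(* Steps of length [k] are used; since [al * k] is [-1] modulo [q], the inverse of [k] is
   [q - al]. *)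
- suff -> : (k * (q - al) = k.-1 * q + 1)%N by rewrite modnMDl.
  by case: k k0 qE {lk kE} => // k _ qE; rewrite qE; move: (al) => b; clear; lia.
(* For [0 < j < al], the length [j * k] is at least [k >= l] and at most [q - 1 - k <= q - l], so it
   is an edge of the web. *)
- have jk : (k <= j * k)%N by rewrite leq_pmull //; case/andP: jl.
  have jk' : (j * k + k <= al * k)%N by rewrite -mulSnr leq_mul2r; case/andP: jl => _ ->; rewrite orbT.
  have jq : (j * k < q)%N by rewrite qE; clear - jk'; lia.
  rewrite /antiweb webD // negb_and !negbK; apply/orP; right; apply/orP; left.
  by rewrite (leq_trans lk jk) /= qE; clear - jk' lk; lia.
by rewrite qE => wP; exists al, k, w; split=> //; move: k0; rewrite -kE; case: chi.
Qed.
End CriticalWebs.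

Theorem theorem6 (R : realType) (d : Order.disp_t) (V : finOrderType d)
    (e : rel V) (e_sym : symmetric e) (e_irr : irreflexive e)
    (p : V -> nat) (p_gt0 : forall v, (0 < p v)%N) (U : {set V}) :
  (is_web (induced e U) \/ is_antiweb (induced e U)) ->
  chi_critical (induced e U) ->
  facet_defining (rep_polytope e R p) (ineq_lhs e R U)
    ((chi (induced e U))%:R - #|srcs_in e U|%:R).
Proof.
move=> web crit.
have {web} [al [k [w [al1 k0 chiE [w_in w_surj w_inj w_st]]]]] :
    exists al k w, [/\ (1 < al)%N, (0 < k)%N, chi (induced e U) = k.+1 & cyclic_structure e U al k w].
  by case: web => [/web_structure|/antiweb_structure]; apply.
have pY := lexx (\sum_v (p v)%:R : R).
have [col colP col_lt] := chi_coloring e_irr U.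
have [rmap rcount] := class_rep_on_face e_irr colP col_lt.
apply: facet_criterion.
- by move=> z; apply: ineq_valid_polytope.
- exists (point e (\sum_v (p v)%:R) (rep_system (class_rep U col))); split.
    exact: (point_in_polytope pY (repmap_system rmap)).
  by rewrite /= lhs_repmap // -rcount natrD addrK.
(* When every vertex represents itself, the left-hand side is [#|U| - #|S_U|]; this exceeds the
   bound because [#|U|] is at least [al * k + 1], hence more than [k + 1]. *)
- have idmap : repmap e id.
    by split=> [v|v|u v ->] //; rewrite ?in_setU1 ?eqxx ?e_irr.
  exists (point e (\sum_v (p v)%:R) (rep_system id)); split.
    exact: (point_in_polytope pY (repmap_system idmap)).
  rewrite /= lhs_repmap // eq_sym subr_eq -natrD eqr_nat.
  have -> : repcount e U id = U :\: srcs_in e U.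
    by apply/setP => v; rewrite [LHS]inE eqxx andbT.
  have SU : srcs_in e U \subset U by apply/subsetP => v; rewrite inE => /andP[].
  rewrite cardsDS // subnK ?subset_leq_card //.
  rewrite chiE ltn_eqF //.
  have : (#|'I_(al * k).+1| <= #|U|)%N.
    rewrite -(card_imset _ (f := fun i : 'I_(al * k).+1 => w i)).
      by apply: subset_leq_card; apply/subsetP => _ /imsetP[i _ ->].
    by move=> i j /(w_inj 0%N _ _ (ltn_ord i) (ltn_ord j))/val_inj.
  by rewrite card_ord; apply: leq_trans; rewrite ltnS ltn_Pmull.
move=> phi [C phiC].
(* A vertex of [U] outside [S_U] has an earlier non-neighbor in [U], which is what the exchange
   argument asks for. *)
have const v v' : v \in U :\: srcs_in e U -> v' \in U :\: srcs_in e U ->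
    coef phi v v = coef phi v' v'.
  have smaller x : x \in U :\: srcs_in e U -> x \in U /\ exists u, [/\ u \in U, (u < x)%O & ~~ e u x].
    move=> /setDP[xU]; rewrite inE xU => /set0Pn[u /setIP[]].
    by rewrite inE => /andP[ux uxe] uU; split=> //; exists u.
  move=> /smaller[vU vs] /smaller[v'U v's].
  apply: (g_const e_sym e_irr al1 k0 erefl w_in w_surj w_inj w_st
            (g := fun v => coef phi v v) (C := C)) => // c cP c_lt.
  apply: (coef_sum_min e_sym e_irr crit phiC cP) => x xU.
  by rewrite chiE ltnS c_lt.
have [E|/set0Pn[v0 v0U]] := eqVneq (U :\: srcs_in e U) set0.
  by exists 0; apply: (phi_multiple e_sym e_irr crit phiC) => v; rewrite E inE.
exists (coef phi v0 v0); apply: (phi_multiple e_sym e_irr crit phiC) => v vU.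
exact: const.
Qed.
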